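(* Let $k\ge1$ be an integer and let $F\in V_k\Lambda^2(\mathfrak N^4)$ be a polynomial 2-form for which all the degrees of freedom $\Sigma^{k,2}(\mathfrak N^4)$ vanish. Then $F\equiv0$.
   Context: The reference tetrahedral prism is $\mathfrak N^4=\mathfrak T^3\times\mathfrak T^1$, where $\mathfrak T^3=\{(x_1,x_2,x_3): -1\le x_i\le1,\ x_1+x_2+x_3\le-1\}$ is a tetrahedron with vertices $(1,-1,-1),(-1,1,-1),(-1,-1,1),(-1,-1,-1)$ and barycentric coordinates $\lambda_1,\dots,\lambda_4$ (in that order), and $\mathfrak T^1=[-1,1]$ (variable $x_4$) with barycentric coordinates $\nu_1,\nu_2$. It has 8 triangular faces (in $x_4=\pm1$), 6 quadrilateral faces (edge of $\mathfrak T^3$ times $\mathfrak T^1$), 2 tetrahedral facets ($x_4=\pm1$) and 4 triangular-prism facets (triangular face of $\mathfrak T^3$ times $\mathfrak T^1$). $P^j(\cdot)$ are polynomials of total degree $\le j$ on the indicated set ($\{0\}$ if $j<0$), $\tilde P^j$ homogeneous of degree exactly $j$ (together with $0$); $A\times B$ of spaces means the span of products; $Q^{a,b}$ on a quadrilateral face is the space of polynomials of degree $\le a$ along the edge of $\mathfrak T^3$ and $\le b$ in $x_4$. $dP^j$ is the same polynomial space as $P^j$ (the notation only indicates that no inter-element continuity is imposed). $e_4$ is the $x_4$ unit vector. $\mathcal L$ sends $(w_{12},w_{13},w_{14},w_{23},w_{24},w_{34})\in\mathbb R^6$ to the skew-symmetric $4\times4$ matrix with those upper-triangular entries. $A:B=\sum_{ij}A_{ij}B_{ij}$.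 With $y=(x_1,x_2,x_3)$ let $N^{k-1}(\mathfrak T^3)=(P^{k-1}(\mathfrak T^3))^3\oplus\{p\in(\tilde P^k(\mathfrak T^3))^3:p\cdot y=0\}$ and $RT^{k-1}(\mathfrak T^3)=(P^{k-1}(\mathfrak T^3))^3\oplus\tilde P^{k-1}(\mathfrak T^3)\,y$. Then $V_k\Lambda^2(\mathfrak N^4)$ is the direct sum of $$P^{k-1}(\mathfrak T^1)\times\{\mathcal L([0,0,p_1,0,p_2,p_3]^T):p\in N^{k-1}(\mathfrak T^3)\}$$ and $$P^k(\mathfrak T^1)\times\{\mathcal L([w_3,-w_2,0,w_1,0,0]^T):w\in RT^{k-1}(\mathfrak T^3)\}.$$ For $r=1,2,3$ let $(a,b,c,d)=(1,2,3,4),(2,3,4,1),(3,4,1,2)$ respectively, and $\Phi^{b,r}=\lambda_c\lambda_d$, $N^r=\lambda_a\nabla\lambda_b-\lambda_b\nabla\lambda_a$, $\Psi^{b,r}=\lambda_d$, $\mathcal N^r=\lambda_a\nabla\lambda_b\times\nabla\lambda_c+\lambda_b\nabla\lambda_c\times\nabla\lambda_a+\lambda_c\nabla\lambda_a\times\nabla\lambda_b$ (3-vectors in $x_1,x_2,x_3$, ordinary cross product in $\mathbb R^3$). Put $\vartheta^b(x_4)=\nu_1\nu_2$. For a facet $\mathcal F$ with unit normal $n$, the trace of $F$ on $\mathcal F$ is the tangent vector $\mathrm{Tr}(F)=n\times F$, $[n\times F]_i=\sum_{j,k,l}\varepsilon_{ijkl}n_jF_{kl}$ ($\varepsilon$ the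 Levi-Civita symbol). For a 2-dimensional face $f$, choose a facet $\mathcal F\supset f$ and let $\nu$ be the unit normal to $f$ within $\mathcal F$; $\mathrm{Tr}(F)\cdot\nu$ is independent of the choice up to sign. Degrees of freedom $\Sigma^{k,2}(\mathfrak N^4)$ of $F$: - $\int_f(\mathrm{Tr}(F)\cdot\nu)q$, $q\in P^{k-1}(f)$, each triangular face $f$; - $\int_f(\mathrm{Tr}(F)\cdot\nu)q$, $q\in Q^{k-1,k-1}(f)$, each quadrilateral face $f$; - $\int_{\mathcal F}\mathrm{Tr}(F)\cdot q$, each tetrahedral facet $\mathcal F$ and each $q$ tangent to $\mathcal F$ with components in $P^{k-2}(\mathcal F)$; - for each triangular-prism facet $\mathcal F=T\times\mathfrak T^1$: $\int_{\mathcal F}\mathrm{Tr}(F)\cdot q$ for $q$ tangent to $T$ with components in $P^{k-1}(\mathfrak T^1)\times P^{k-2}(T)$, and $\int_{\mathcal F}(\mathrm{Tr}(F)\cdot e_4)q$ for $q\in P^{k-2}(\mathfrak T^1)\times P^{k-1}(T)$; - $\int_{\mathfrak N^4}F:\mathcal L([0,0,s_1,0,s_2,s_3]^T)$ with $s=\sum_{r=1}^3q^r\Phi^{b,r}N^r$, for all $q^1,q^2,q^3\in dP^{k-1}(\mathfrak T^1)\times P^{k-3}(\mathfrak T^3)$; - $\int_{\mathfrak N^4}F:\mathcal L([t_3,-t_2,0,t_1,0,0]^T)$ with $t=\sum_{r=1}^3q^r\Psi^{b,r}\vartheta^b(x_4)\mathcal N^r$, for all $q^1,q^2,q^3\in P^{k-2}(\mathfrak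 T^1)\times P^{k-2}(\mathfrak T^3)$. *)

(* Defs.v *)
From HB Require Import structures.
From mathcomp Require Import all_boot all_order all_algebra.
(* The notations of mpoly clash with those of MathComp-Analysis. *)
From mathcomp.multinomials Require Import -(notations) mpoly.
From mathcomp Require Import lra.
From mathcomp Require Import all_classical all_reals all_analysis.

Set Implicit Arguments.
Unset Strict Implicit.
Unset Printing Implicit Defensive.

Import Order.TTheory GRing.Theory Num.Theory.

Local Open Scope classical_set_scope.
Local Open Scope ring_scope.

(* Coordinates and tetrahedron vertices are numbered from 0: x_1, ..., x_4 are
   the entries 0, ..., 3 of x : 'rV_4. *)

Section Vectors.
Variable R : realType.

Definition dot n (u v : 'rV[R]_n) : R := \sum_(i < n) u 0 i * v 0 i.

(* Indices are taken mod 3. *)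
Definition cross (u v : 'rV[R]_3) : 'rV[R]_3 :=
  \row_(i < 3) (u 0 (i + 1) * v 0 (i + 2) - u 0 (i + 2) * v 0 (i + 1)).

Definition ddot n (A B : 'M[R]_n) : R := \sum_(i < n) \sum_(j < n) A i j * B i j.

Definition snoc n (v : 'rV[R]_n) (t : R) : 'rV[R]_(n + 1) := row_mx v t%:M.

Definition pt (y : 'rV[R]_3) (t : R) : 'rV[R]_4 := snoc y t.
Definition xyz (x : 'rV[R]_4) : 'rV[R]_3 := @lsubmx R 1 3 1 x.
Definition height (x : 'rV[R]_4) : R := x 0 3.

Definition e4 : 'rV[R]_4 := pt 0 1.

Definition levi_civita (i j k l : 'I_4) : R :=
  (sgz (j%:Z - i%:Z) * sgz (k%:Z - i%:Z) * sgz (l%:Z - i%:Z)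
   * sgz (k%:Z - j%:Z) * sgz (l%:Z - j%:Z) * sgz (l%:Z - k%:Z))%:~R.

Definition trace2 (n : 'rV[R]_4) (F : 'M[R]_4) : 'rV[R]_4 :=
  \row_(i < 4) \sum_(j < 4) \sum_(k < 4) \sum_(l < 4)
    levi_civita i j k l * n 0 j * F k l.

Definition calL (w12 w13 w14 w23 w24 w34 : R) : 'M[R]_4 :=
  \matrix_(i < 4, j < 4) nth 0 (nth [::]
    [:: [::    0;   w12;   w13; w14];
        [:: -w12;     0;   w23; w24];
        [:: -w13;  -w23;     0; w34];
        [:: -w14;  -w24;  -w34;   0]] i) j.

Definition skewN (p : 'rV[R]_3) : 'M[R]_4 := calL 0 0 (p 0 0) 0 (p 0 1) (p 0 2).
Definition skewRT (w : 'rV[R]_3) : 'M[R]_4 := calL (w 0 2) (- w 0 1) 0 (w 0 0) 0 0.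

End Vectors.

Section Polynomials.
Variable R : realType.

(* The degree bounds are integers, so that a negative bound gives {0}: size and
   msize are 1 + the degree, and are 0 only for the zero polynomial. *)
Definition polyfun1 (j : int) : set (R -> R) :=
  [set f | exists2 p : {poly R}, (size p)%:Z <= j + 1 & forall t, f t = p.[t]].

Definition polyfun n (j : int) : set ('rV[R]_n -> R) :=
  [set f | exists2 p : mpoly n R,
     (mmeasure mdeg p)%:Z <= j + 1
     & forall y : 'rV[R]_n, f y = meval (fun i => y 0 i) p].

Definition homog n (j : nat) : set ('rV[R]_n -> R) :=
  [set f | exists2 p : mpoly n R,
     p \is ishomog1 j mdeg
     & forall y : 'rV[R]_n, f y = meval (fun i => y 0 i) p].

(* The span of the products a(x_4) b(x_1, x_2, x_3). *)
Definition prodspan (V : lmodType R)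
    (A : set (R -> R)) (B : set ('rV[R]_3 -> V)) : set ('rV[R]_4 -> V) :=
  [set f | exists n (a : 'I_n -> R -> R) (b : 'I_n -> 'rV[R]_3 -> V),
     [/\ forall i, A (a i), forall i, B (b i)
       & forall x, f x = \sum_(i < n) a i (height x) *: b i (xyz x)]].

Definition prodpoly (a b : int) : set ('rV[R]_4 -> R) :=
  @prodspan R^o (polyfun1 a) (polyfun b).

Definition nedelec (k : nat) : set ('rV[R]_3 -> 'rV[R]_3) :=
  [set p | exists p1 p2 : 'rV[R]_3 -> 'rV[R]_3,
     [/\ forall i, polyfun (k%:Z - 1) (fun y => p1 y 0 i),
         forall i, homog k (fun y => p2 y 0 i),
         forall y, dot (p2 y) y = 0
       & forall y, p y = p1 y + p2 y]].

Definition raviart_thomas (k : nat) : set ('rV[R]_3 -> 'rV[R]_3) :=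
  [set w | exists (w1 : 'rV[R]_3 -> 'rV[R]_3) (h : 'rV[R]_3 -> R),
     [/\ forall i, polyfun (k%:Z - 1) (fun y => w1 y 0 i),
         homog k.-1 h
       & forall y, w y = w1 y + h y *: y]].

Definition V2 (k : nat) : set ('rV[R]_4 -> 'M[R]_4) :=
  [set F | exists F1 F2 : 'rV[R]_4 -> 'M[R]_4,
     [/\ prodspan (polyfun1 (k%:Z - 1)) [set (fun y => skewN (p y)) | p in nedelec k] F1,
         prodspan (polyfun1 k) [set (fun y => skewRT (w y)) | w in raviart_thomas k] F2
       & forall x, F x = F1 x + F2 x]].

End Polynomials.

Section Geometry.
Variable R : realType.

Definition T3 : set 'rV[R]_3 :=
  [set y | (forall i, -1 <= y 0 i <= 1) /\ \sum_(i < 3) y 0 i <= -1].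
Definition T1 : set R := [set t | -1 <= t <= 1].
Definition N4 : set 'rV[R]_4 := [set x | T3 (xyz x) /\ T1 (height x)].

Definition vert (m : 'I_4) : 'rV[R]_3 :=
  \row_(i < 3) (if m == i :> nat then 1 else -1).

(* lambda_i = (1 + x_i) / 2 for i = 1, 2, 3 and
   lambda_4 = - (1 + x_1 + x_2 + x_3) / 2, with constant gradients. *)
Definition grad_lam (m : 'I_4) : 'rV[R]_3 :=
  \row_(i < 3) (if m == 3 then - 2^-1 else (m == i :> nat)%:R / 2).
Definition lam (m : 'I_4) (y : 'rV[R]_3) : R :=
  (if m == 3 then - 2^-1 else 2^-1) + dot (grad_lam m) y.

Lemma lam_vert (m n : 'I_4) : lam m (vert n) = (m == n)%:R.
Proof.
rewrite /lam /dot !big_ord_recr big_ord0 /= !mxE -!val_eqE /=.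
by case: m => [[|[|[|[|//]]]] ?] /=; case: n => [[|[|[|[|//]]]] ?] /=; lra.
Qed.

Definition nu1 (t : R) : R := (1 - t) / 2.
Definition nu2 (t : R) : R := (1 + t) / 2.

Definition endpoint (b : bool) : R := if b then 1 else -1.

(* [Tri m b]: the triangle of T3 opposite vertex m, in x_4 = endpoint b;
   [Quad lt_ij]: the edge ij of T3 times T1. *)
Inductive face : Type :=
  | Tri of 'I_4 & bool
  | Quad (i j : 'I_4) of (i < j)%N.

(* [Tet b]: T3 in x_4 = endpoint b;
   [Prism m]: the triangle of T3 opposite vertex m times T1. *)
Inductive facet : Type :=
  | Tet of bool
  | Prism of 'I_4.

Definition triangle (m : 'I_4) : set 'rV[R]_3 := [set y | T3 y /\ lam m y = 0].
Definition edge (i j : 'I_4) : set 'rV[R]_3 :=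
  [set y | T3 y /\ forall m, m != i -> m != j -> lam m y = 0].

Definition face_set (f : face) : set 'rV[R]_4 :=
  match f with
  | Tri m b => [set x | triangle m (xyz x) /\ height x = endpoint b]
  | Quad i j _ => [set x | edge i j (xyz x) /\ T1 (height x)]
  end.

Definition facet_set (G : facet) : set 'rV[R]_4 :=
  match G with
  | Tet b => [set x | T3 (xyz x) /\ height x = endpoint b]
  | Prism m => [set x | triangle m (xyz x) /\ T1 (height x)]
  end.

(* v is orthogonal, resp. parallel, to the affine hull of S. *)
Definition normal_to n (S : set 'rV[R]_n) (v : 'rV[R]_n) : Prop :=
  forall x y, S x -> S y -> dot v (x - y) = 0.
Definition tangent_to n (S : set 'rV[R]_n) (v : 'rV[R]_n) : Prop :=
  forall u, normal_to S u -> dot u v = 0.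

(* The degrees of freedom leave open which facet containing a face is used, and
   the signs of the unit normals; [unit_conormal f] is normal to f within
   [host f]. *)
Record face_choice := FaceChoice {
  unit_normal : facet -> 'rV[R]_4;
  unit_normalP : forall G, normal_to (facet_set G) (unit_normal G)
                      /\ dot (unit_normal G) (unit_normal G) = 1;
  host : face -> facet;
  hostP : forall f, face_set f `<=` facet_set (host f);
  unit_conormal : face -> 'rV[R]_4;
  unit_conormalP : forall f, [/\ tangent_to (facet_set (host f)) (unit_conormal f),
                            normal_to (face_set f) (unit_conormal f)
                          & dot (unit_conormal f) (unit_conormal f) = 1]
}.

End Geometry.

Section Integrals.
Variable R : realType.

Local Notation mu := (@lebesgue_measure R).
Local Notation mu2 := (mu \x mu)%E.
Local Notation mu3 := (mu2 \x mu)%E.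
Local Notation mu4 := (mu3 \x mu)%E.

Definition row2 (u : R * R) : 'rV[R]_2 := snoc u.1%:M u.2.
Definition row3 (u : R * R * R) : 'rV[R]_3 := snoc (row2 u.1) u.2.
Definition row4 (u : R * R * R * R) : 'rV[R]_4 := snoc (row3 u.1) u.2.

(* The surface integral over S of g, where S lies in the affine plane through o
   directed by the rows of J: the integral over the preimage of S under the
   parametrization u |-> o + u J, times the Gram determinant area factor. *)
Definition int2 (o : 'rV[R]_4) (J : 'M[R]_(2, 4)) (S : set 'rV[R]_4)
    (g : 'rV[R]_4 -> R) : R :=
  Num.sqrt (\det (J *m J^T)) *
  \int[mu2]_(u in [set u | S (o + row2 u *m J)]) g (o + row2 u *m J).

Definition int3 (o : 'rV[R]_4) (J : 'M[R]_(3, 4)) (S : set 'rV[R]_4)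
    (g : 'rV[R]_4 -> R) : R :=
  Num.sqrt (\det (J *m J^T)) *
  \int[mu3]_(u in [set u | S (o + row3 u *m J)]) g (o + row3 u *m J).

Definition intN4 (g : 'rV[R]_4 -> R) : R :=
  \int[mu4]_(u in [set u | N4 (row4 u)]) g (row4 u).

Definition triangle_frame (m : 'I_4) : 'M[R]_(2, 4) :=
  \matrix_(i < 2) pt (vert R (lift m (lift ord0 i)) - vert R (lift m ord0)) 0.

Definition face_origin (f : face) : 'rV[R]_4 :=
  match f with
  | Tri m b => pt (vert R (lift m ord0)) (endpoint R b)
  | Quad i j _ => pt (vert R i) 0
  end.
Definition face_frame (f : face) : 'M[R]_(2, 4) :=
  match f with
  | Tri m b => triangle_frame m
  | Quad i j _ => col_mx (pt (vert R j - vert R i) 0) (e4 R)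
  end.
Definition face_int (f : face) (g : 'rV[R]_4 -> R) : R :=
  int2 (face_origin f) (face_frame f) (face_set f) g.

Definition facet_origin (G : facet) : 'rV[R]_4 :=
  match G with
  | Tet b => pt 0 (endpoint R b)
  | Prism m => pt (vert R (lift m ord0)) 0
  end.
Definition facet_frame (G : facet) : 'M[R]_(3, 4) :=
  match G with
  | Tet b => \matrix_(i < 3) pt (delta_mx 0 i) 0
  | Prism m => col_mx (triangle_frame m) (e4 R)
  end.
Definition facet_int (G : facet) (g : 'rV[R]_4 -> R) : R :=
  int3 (facet_origin G) (facet_frame G) (facet_set G) g.

End Integrals.

Section DegreesOfFreedom.
Variable R : realType.

(* (a, b, c, d) = (idx r 0, idx r 1, idx r 2, idx r 3), cyclically mod 4. *)
Definition idx (r : 'I_3) (j : nat) : 'I_4 := inZp (r + j).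

Definition PhiN (r : 'I_3) (y : 'rV[R]_3) : R :=
  lam (idx r 2) y * lam (idx r 3) y.
Definition vecN (r : 'I_3) (y : 'rV[R]_3) : 'rV[R]_3 :=
  lam (idx r 0) y *: grad_lam R (idx r 1) - lam (idx r 1) y *: grad_lam R (idx r 0).

Definition PsiRT (r : 'I_3) (y : 'rV[R]_3) : R := lam (idx r 3) y.
Definition vecRT (r : 'I_3) (y : 'rV[R]_3) : 'rV[R]_3 :=
  let a := idx r 0 in let b := idx r 1 in let c := idx r 2 in
  lam a y *: cross (grad_lam R b) (grad_lam R c)
  + lam b y *: cross (grad_lam R c) (grad_lam R a)
  + lam c y *: cross (grad_lam R a) (grad_lam R b).

Definition bubble1 (t : R) : R := nu1 t * nu2 t.

Definition facet_trace (c : face_choice R) (G : facet) (F : 'rV[R]_4 -> 'M[R]_4)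
    (x : 'rV[R]_4) : 'rV[R]_4 :=
  trace2 (unit_normal c G) (F x).

Definition face_trace (c : face_choice R) (f : face) (F : 'rV[R]_4 -> 'M[R]_4)
    (x : 'rV[R]_4) : R :=
  dot (facet_trace c (host c f) F x) (unit_conormal c f).

(* A polynomial on a lower-dimensional set is the restriction of a polynomial in
   the ambient coordinates, so the scalar test functions are taken in the
   latter. *)
Record dofs_vanish (k : nat) (c : face_choice R) (F : 'rV[R]_4 -> 'M[R]_4) : Prop :=
  DofsVanish {
  dof_tri : forall m b (q : 'rV[R]_4 -> R), polyfun (k%:Z - 1) q ->
    face_int (Tri m b) (fun x => face_trace c (Tri m b) F x * q x) = 0;
  dof_quad : forall (i j : 'I_4) (ij : (i < j)%N) (q : 'rV[R]_4 -> R),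
    prodpoly (k%:Z - 1) (k%:Z - 1) q ->
    face_int (Quad ij) (fun x => face_trace c (Quad ij) F x * q x) = 0;
  dof_tet : forall b (q : 'rV[R]_4 -> 'rV[R]_4),
    (forall x, facet_set (Tet b) x -> tangent_to (facet_set (Tet b)) (q x)) ->
    (forall i, polyfun (k%:Z - 2) (fun x => q x 0 i)) ->
    facet_int (Tet b) (fun x => dot (facet_trace c (Tet b) F x) (q x)) = 0;
  dof_prism_tangent : forall m (q : 'rV[R]_4 -> 'rV[R]_3),
    (forall x, facet_set (Prism m) x -> tangent_to (triangle m) (q x)) ->
    (forall i, prodpoly (k%:Z - 1) (k%:Z - 2) (fun x => q x 0 i)) ->
    facet_int (Prism m) (fun x => dot (facet_trace c (Prism m) F x) (pt (q x) 0)) = 0;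
  dof_prism_e4 : forall m (q : 'rV[R]_4 -> R),
    prodpoly (k%:Z - 2) (k%:Z - 1) q ->
    facet_int (Prism m) (fun x => dot (facet_trace c (Prism m) F x) (e4 R) * q x) = 0;
  dof_inner_N : forall q : 'I_3 -> 'rV[R]_4 -> R,
    (forall r, prodpoly (k%:Z - 1) (k%:Z - 3) (q r)) ->
    intN4 (fun x => ddot (F x) (skewN
      (\sum_(r < 3) (q r x * PhiN r (xyz x)) *: vecN r (xyz x)))) = 0;
  dof_inner_RT : forall q : 'I_3 -> 'rV[R]_4 -> R,
    (forall r, prodpoly (k%:Z - 2) (k%:Z - 2) (q r)) ->
    intN4 (fun x => ddot (F x) (skewRT
      (\sum_(r < 3) (q r x * PsiRT r (xyz x) * bubble1 (height x))
                      *: vecRT r (xyz x)))) = 0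
}.

End DegreesOfFreedom.

(* Main.v *)
From HB Require Import structures.
Require Import Defs.
From mathcomp Require Import all_boot all_order all_algebra.
From mathcomp.multinomials Require Import -(notations) mpoly.
From mathcomp Require Import ring lra zify.
From mathcomp Require Import all_classical all_reals all_analysis.
From mathcomp Require Import measurable_realfun.

Set Implicit Arguments.
Unset Strict Implicit.
Unset Printing Implicit Defensive.

Import Order.TTheory GRing.Theory Num.Theory.
Import numFieldNormedType.Exports.

Local Open Scope classical_set_scope.
Local Open Scope ring_scope.

(** The two summands of F are a field p with F_14, F_24, F_34 as entries and a
    field w with F_23, - F_13, F_12 as entries.  For each height x_4, p lies in
    the Nedelec space and w in the Raviart-Thomas space of the tetrahedron, and
    in x_4 they are polynomials:
      p = sum_j x_4^j P_j,   w = A + x_4 B + (1 - x_4^2) sum_j x_4^j W_j.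
    The trace on a base x_4 = +-1 is a multiple of w; on a lateral facet with
    horizontal normal g it is a multiple of (g x p, - g.w).  Hence the two fields
    never meet in a degree of freedom, and each set of degrees of freedom kills
    one more trace, always in the same way: the part of the trace that is already
    known to vanish on the boundary is divided out, the quotient has just the
    degree allowed for a test function, and testing with it makes the integrand a
    sum of squares with nonnegative weights.  A nonnegative polynomial with zero
    integral over a set with nonempty interior is zero (integral_pol_eq0), and
    the zero spreads from that set to the affine hull.

    The algebra behind the divisions is the following.  Let v_m be the vertices,
    lam_m the barycentric coordinates and g_m their gradients, so that
    g_m.(y - v_d) = lam_m - [m = d].

    For a Raviart-Thomas field w = v + h y, the function g_m.w - lam_m h has
    degree below k (rt_flux); if it vanishes where lam_m does, then
    g_m.w = lam_m (h + e_m) with deg e_m <= k - 2 (rt_factor).  As the g_m add up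
    to 0, testing with sum_m e_m g_m gives sum_m lam_m (h + e_m)^2, which shows
    that w vanishes on the bases (base_zero).  The same e_m give
    W_j = sum_d (e_3 - e_d) lam_d (y - v_d) (rt_bubble), where e_3 belongs to the
    third vertex.  The fields y - v_d, for d other than that vertex, are
    multiples of the fields used in the interior degrees of freedom, so that W_j
    itself, times the bubble of x_4, is a test field (W_zero).

    For a Nedelec field p, the functions s_m = p.(y - v_m) have degree at most k,
    and sum_m lam_m s_m = 0.  On an edge, s_i is lam_j times the tangential
    component, which therefore drops one degree (ned_edge).  On a face with
    vertices a, b, d, once the edge components vanish, s_a = lam_b lam_d q_a,
    s_b = lam_a lam_d q_b and s_d = - lam_a lam_b (q_a + q_b); testing with
    q_a (v_a - v_d) + q_b (v_b - v_d) gives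
    lam_a lam_b (q_a + q_b)^2 + lam_b lam_d q_a^2 + lam_a lam_d q_b^2 up to sign
    (P_face_null).  In the interior each s_m is then a multiple of the other three
    coordinates, and solving for p in terms of the s_m writes it as a combination
    of the test fields (ned_bubble), so that p is orthogonal to itself (p_zero). *)

(** * Finite index sets *)

Lemma ord3_ind (P : 'I_3 -> Prop) : P 0 -> P 1 -> P 2 -> forall i, P i.
Proof.
by move=> P0 P1 P2 [[|[|[|//]]] lt_i]; [move: P0|move: P1|move: P2];
  congr (P _); exact: val_inj.
Qed.

Lemma ord4_ind (P : 'I_4 -> Prop) : P 0 -> P 1 -> P 2 -> P 3 -> forall i, P i.
Proof.
by move=> P0 P1 P2 P3 [[|[|[|[|//]]]] lt_i];
  [move: P0|move: P1|move: P2|move: P3]; congr (P _); exact: val_inj.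
Qed.

Lemma sum3E (V : nmodType) (F : 'I_3 -> V) : \sum_(i < 3) F i = F 0 + F 1 + F 2.
Proof.
by rewrite !big_ord_recr big_ord0 /= add0r; congr (F _ + F _ + F _); exact: val_inj.
Qed.

Lemma sum4E (V : nmodType) (F : 'I_4 -> V) :
  \sum_(i < 4) F i = F 0 + F 1 + F 2 + F 3.
Proof.
rewrite !big_ord_recr big_ord0 /= add0r.
by congr (F _ + F _ + F _ + F _); exact: val_inj.
Qed.

(** * Polynomial functions and their degrees *)

Section PolynomialFunctions.
Variable R : realType.

(** Polynomial functions given by closure rules, so that every property below
    is an induction on how the function is built.  The bound s is one more than
    the degree, and s = 0 leaves only the zero function; with truncated
    subtraction on s this is the convention for negative degrees. *)
Inductive pol (n : nat) : nat -> ('rV[R]_n -> R) -> Prop :=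
  | pol0 s : pol s (fun=> 0)
  | polC s c : pol s.+1 (fun=> c)
  | polD s f g : pol s f -> pol s g -> pol s (fun y => f y + g y)
  | polX s i f : pol s f -> pol s.+1 (fun y => y 0 i * f y).

Definition vpol (n m s : nat) (p : 'rV[R]_n -> 'rV[R]_m) : Prop :=
  forall i, pol s (fun y => p y 0 i).

Lemma pol_ext n s (f g : 'rV[R]_n -> R) : pol s f -> f =1 g -> pol s g.
Proof. by move=> pf /funext <-. Qed.

Lemma pol_size0 n (f : 'rV[R]_n -> R) : pol 0 f -> forall y, f y = 0.
Proof.
suff gen s (g : 'rV[R]_n -> R) : pol s g -> s = 0%N -> forall y, g y = 0.
  by move=> /gen; apply.
elim=> // {}s {}f h _ ihf _ ihh s0 y.
by rewrite ihf// ihh// addr0.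
Qed.

Lemma pol_le n s s' (f : 'rV[R]_n -> R) : pol s f -> (s <= s')%N -> pol s' f.
Proof.
move=> pf; elim: pf s' => {s f}.
- by move=> s s' _; exact: pol0.
- by move=> s c [//|s'] _; exact: polC.
- by move=> s f g _ ihf _ ihg s' ss'; apply: polD; [exact: ihf|exact: ihg].
- by move=> s i f _ ih [//|s'] ss'; apply: polX; exact: ih.
Qed.

Lemma polZ n s c (f : 'rV[R]_n -> R) : pol s f -> pol s (fun y => c * f y).
Proof.
elim=> {s f}.
- by move=> s; apply: pol_ext (pol0 _ s) _ => y; rewrite mulr0.
- by move=> s c'; exact: polC.
- move=> s f g _ ihf _ ihg.
  by apply: pol_ext (polD ihf ihg) _ => y; rewrite mulrDr.
- by move=> s i f _ ih; apply: pol_ext (polX i ih) _ => y; rewrite mulrCA.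
Qed.

Lemma polB n s (f g : 'rV[R]_n -> R) :
  pol s f -> pol s g -> pol s (fun y => f y - g y).
Proof.
move=> pf pg; apply: pol_ext (polD pf (polZ (-1) pg)) _ => y.
by rewrite mulN1r.
Qed.

Lemma pol_sum n s (I : Type) (r : seq I) (f : I -> 'rV[R]_n -> R) :
  (forall i, pol s (f i)) -> pol s (fun y => \sum_(i <- r) f i y).
Proof.
move=> pf; elim: r => [|i r ih].
  by apply: pol_ext (pol0 _ s) _ => y; rewrite big_nil.
by apply: pol_ext (polD (pf i) ih) _ => y; rewrite big_cons.
Qed.

Lemma polM n s s' (f g : 'rV[R]_n -> R) :
  pol s f -> pol s' g -> pol (s + s').-1 (fun y => f y * g y).
Proof.
move=> pf; elim: pf s' g => {s f}.
- by move=> s s' g _; apply: pol_ext (pol0 _ _) _ => y; rewrite mul0r.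
- move=> s c s' g pg; apply: pol_le (polZ c pg) _.
  by rewrite addSn /= leq_addl.
- move=> s f1 f2 _ ih1 _ ih2 s' g pg.
  by apply: pol_ext (polD (ih1 _ _ pg) (ih2 _ _ pg)) _ => y; rewrite mulrDl.
- move=> [|s] i f pf ih s' g pg.
    apply: pol_ext (pol0 _ _) _ => y.
    by rewrite (pol_size0 pf) mulr0 mul0r.
  by apply: pol_ext (polX i (ih _ _ pg)) _ => y; rewrite mulrA.
Qed.

Lemma pol_coord n i : pol 2 (fun y : 'rV[R]_n => y 0 i).
Proof. by apply: pol_ext (polX i (polC _ 0 1)) _ => y; rewrite mulr1. Qed.

Lemma pol_dot n m s s' (p q : 'rV[R]_n -> 'rV[R]_m) :
  vpol s p -> vpol s' q -> pol (s + s').-1 (fun y => dot (p y) (q y)).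
Proof. by move=> pp pq; apply: pol_sum => i; exact: polM. Qed.

Lemma vpolC n m s (a : 'rV[R]_m) : vpol s.+1 (fun _ : 'rV[R]_n => a).
Proof. by move=> i; exact: polC. Qed.

Lemma pol_dotC n m s (p : 'rV[R]_n -> 'rV[R]_m) (a : 'rV[R]_m) :
  vpol s p -> pol s (fun y => dot (p y) a).
Proof.
move=> pp; apply: pol_sum => i.
by apply: pol_ext (polZ (a 0 i) (pp i)) _ => y; rewrite mulrC.
Qed.

Lemma pol_comp n m s (f : 'rV[R]_n -> R) (E : 'rV[R]_m -> 'rV[R]_n) :
  pol s f -> vpol 2 E -> pol s (fun z => f (E z)).
Proof.
move=> pf pE; elim: pf => {s f}.
- by move=> s; exact: pol0.
- by move=> s c; exact: polC.
- by move=> s f g _ ihf _ ihg; exact: polD.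
- by move=> s i f _ ih; exact: (polM (pE i) ih).
Qed.

Lemma pol_meval n (p : mpoly n R) :
  pol (msize p) (fun y => meval (fun i => y 0 i) p).
Proof.
have pol_pow (m : nat) i : pol m.+1 (fun y : 'rV[R]_n => y 0 i ^+ m).
  elim: m => [|m ih]; first exact: polC.
  by apply: pol_ext (polX i ih) _ => y; rewrite exprS.
have pol_prod (r : seq 'I_n) (m : 'I_n -> nat) :
    pol (\sum_(i <- r) m i).+1 (fun y : 'rV[R]_n => \prod_(i <- r) y 0 i ^+ m i).
  elim: r => [|i r ih].
    by apply: pol_ext (polC _ _ 1) _ => y; rewrite big_nil.
  apply: pol_ext (pol_le (polM (pol_pow (m i) i) ih) _) _.
    by rewrite big_cons addSn addnS.
  by move=> y; rewrite big_cons.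
have : pol (msize p)
    (fun y => \sum_(m <- msupp p) (mcoeff m p) * \prod_i y 0 i ^+ m i).
  have : {subset msupp p <= msupp p} by [].
  elim: {1 3}(msupp p) => [|m r ih] sub.
    by apply: pol_ext (pol0 _ _) _ => y; rewrite big_nil.
  apply: pol_ext (polD (f := fun y => mcoeff m p * \prod_i y 0 i ^+ m i) _
    (ih _)) _.
  - apply: polZ; apply: pol_le (pol_prod _ _) _.
    by rewrite -mdegE msize_mdeg_lt// sub// mem_head.
  - by move=> m' m'r; rewrite sub// in_cons m'r orbT.
  - by move=> y; rewrite big_cons.
by move=> h; apply: pol_ext h _ => y; rewrite mevalE.
Qed.

(** Passage from a representing polynomial to the closure rules; pol_polyfun
    goes back. *)
Lemma polyfun_pol n (j : int) s (f : 'rV[R]_n -> R) :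
  polyfun j f -> j + 1 <= s%:Z -> pol s f.
Proof.
case=> p pj fE js.
apply: pol_ext (pol_le (pol_meval p) _) _; last by move=> y; rewrite fE.
by rewrite -lez_nat (le_trans pj).
Qed.

Lemma homog_pol n j (f : 'rV[R]_n -> R) : homog j f -> pol j.+1 f.
Proof.
case=> p /dhomogP hp fE.
apply: pol_ext (pol_le (pol_meval p) _) _; last by move=> y; rewrite fE.
by rewrite msizeE; apply/bigmax_leqP_seq => m /hp /= ->.
Qed.

Lemma pol_polyfun n (j : int) s (f : 'rV[R]_n -> R) :
  pol s f -> s%:Z <= j + 1 -> polyfun j f.
Proof.
move=> pf sj.
suff [p ps fE] : exists2 p : mpoly n R, (msize p <= s)%N
    & forall y : 'rV[R]_n, f y = meval (fun i => y 0 i) p.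
  by exists p => //; rewrite (le_trans _ sj)// lez_nat.
elim: pf => {s f sj}.
- by move=> s; exists 0 => [|y]; rewrite ?msize0// meval0.
- move=> s c; exists (mpolyC n c) => [|y]; rewrite ?mevalC//.
  by rewrite msizeC; case: eqP.
- move=> s f g _ [p ps fE] _ [q qs gE]; exists (p + q) => [|y].
    by rewrite (leq_trans (msizeD_le _ _))// geq_max ps.
  by rewrite mevalD fE gE.
- move=> s i f _ [p ps fE]; exists (mpolyX R (mnm1 i) * p) => [|y].
    have [->|p0] := eqVneq p 0; first by rewrite mulr0 msize0.
    have X0 : mpolyX R (mnm1 i) != 0 by rewrite -msize_poly_eq0 msizeX.
    by rewrite (msizeM X0 p0) msizeX mdeg1.
  by rewrite mevalM mevalXU fE.
Qed.

End PolynomialFunctions.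

(** * Lines, barycentric coordinates and division *)

Section Lines.
Variable R : realType.

Lemma pol_line n s (f : 'rV[R]_n -> R) (y v : 'rV[R]_n) :
  pol s f -> exists P : {poly R}, forall t, f (y + t *: v) = P.[t].
Proof.
elim=> {s f}.
- by move=> s; exists 0 => t; rewrite horner0.
- by move=> s c; exists c%:P => t; rewrite hornerC.
- by move=> s f g _ [P PE] _ [Q QE]; exists (P + Q) => t; rewrite hornerD PE QE.
- move=> s i f _ [P PE]; exists (((y 0 i)%:P + 'X * (v 0 i)%:P) * P) => t.
  by rewrite !hornerE PE !mxE.
Qed.

(** The points e / (i + 2) are distinct roots, more of them than the degree. *)
Lemma poly_vanish (P : {poly R}) (e : R) :
  0 < e -> (forall t, 0 < t < e -> P.[t] = 0) -> P = 0.
Proof.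
move=> e0 Pe; apply/eqP; apply: contraT => P0.
have := max_poly_roots P0 (rs := [seq e / i.+2%:R | i <- iota 0 (size P)]).
rewrite size_map size_iota ltnn; apply.
  apply/allP => _ /mapP[i _ ->]; apply/rootP; apply: Pe.
  by rewrite divr_gt0// ltr_pdivrMr// ltr_pMr// ltr1n.
rewrite map_inj_uniq ?iota_uniq// => i j /(mulfI (lt0r_neq0 e0))/invr_inj/eqP.
by rewrite eqr_nat => /eqP[].
Qed.

(** A polynomial that vanishes on a line except at one parameter vanishes on
    the whole line: this replaces division by a factor vanishing only there. *)
Lemma pol_cancel n s (f : 'rV[R]_n -> R) (y v : 'rV[R]_n) (t0 : R) :
  pol s f -> (forall t, t != t0 -> f (y + t *: v) = 0) -> f y = 0.
Proof.
move=> /(pol_line y v)[P PE] ft.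
suff P0 : P = 0 by rewrite -[y]addr0 -(scale0r v) PE P0 horner0.
have [t0_gt0|t0_le0] := ltrP 0 t0.
  apply: (poly_vanish t0_gt0) => t /andP[_ tt0].
  by rewrite -PE ft// lt_eqF.
apply: (poly_vanish ltr01) => t /andP[t_gt0 _].
by rewrite -PE ft// gt_eqF// (le_lt_trans t0_le0).
Qed.

Lemma pol_continuous n s (f : 'rV[R]_n -> R) : pol s f -> continuous f.
Proof.
elim=> {s f}.
- by move=> s; exact: cst_continuous.
- by move=> s c; exact: cst_continuous.
- by move=> s f g _ cf _ cg y; apply: continuousD; [exact: cf|exact: cg].
- move=> s i f _ cf y; apply: continuousM; last exact: cf.
  exact: coord_continuous.
Qed.

Lemma pol_gt0_nbhd n s (f : 'rV[R]_n -> R) (y : 'rV[R]_n) :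
  pol s f -> 0 < f y ->
  exists2 d : R, 0 < d &
    forall z : 'rV[R]_n, (forall i, `|z 0 i - y 0 i| < d) -> f y / 2 < f z.
Proof.
move=> /pol_continuous /(_ y) cf fy.
have : \forall z \near y, f y / 2 < f z.
  by move/cvgr_gt : cf; apply; lra.
move=> /nbhs_ballP[d /= d0 yd]; exists d => // z zy.
by apply: yd; split=> // i j; rewrite ord1 /ball/= distrC zy.
Qed.

Lemma pos_region_nbhd n (I : finType) (l : I -> 'rV[R]_n -> R) (s : nat)
    (y : 'rV[R]_n) :
  (forall i, pol s (l i)) -> (forall i, 0 < l i y) ->
  exists2 d : R, 0 < d &
    forall z : 'rV[R]_n, (forall j, `|z 0 j - y 0 j| < d) ->
      forall i, 0 < l i z.
Proof.
move=> pl ly.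
suff [d d0 dl] : exists2 d : R, 0 < d & forall z : 'rV[R]_n,
    (forall j, `|z 0 j - y 0 j| < d) -> forall i, i \in enum I -> 0 < l i z.
  by exists d => // z zy i; apply: (dl z zy); rewrite mem_enum.
elim: (enum I) => [|i r [d d0 dl]]; first by exists 1.
have [d' d'0 dl'] := pol_gt0_nbhd (pl i) (ly i).
exists (Num.min d d') => [|z zy j]; first by rewrite lt_min d0.
rewrite in_cons => /predU1P[->|jr].
  apply: le_lt_trans (dl' z _); first by rewrite divr_ge0// ltW.
  by move=> ?; apply: lt_le_trans (zy _) _; rewrite ge_min lexx orbT.
by apply: dl => // ?; apply: lt_le_trans (zy _) _; rewrite ge_min lexx.
Qed.

(** The segment from y to z starts inside the open region, so the restriction
    of f to its line has infinitely many roots. *)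
Lemma pol_identity n (I : finType) (l : I -> 'rV[R]_n -> R) s s'
    (f : 'rV[R]_n -> R) (y : 'rV[R]_n) :
  (forall i, pol s (l i)) -> (forall i, 0 < l i y) -> pol s' f ->
  (forall z, (forall i, 0 < l i z) -> f z = 0) -> forall z, f z = 0.
Proof.
move=> pl ly pf f0 z.
have [d d0 dl] := pos_region_nbhd pl ly.
have [P PE] := pol_line y (z - y) pf.
have M0 : 0 < 1 + \sum_j `|(z - y) 0 j| by rewrite ltr_pwDl// sumr_ge0.
have P0 : P = 0.
  apply: (@poly_vanish _ (d / (1 + \sum_j `|(z - y) 0 j|))).
    by rewrite divr_gt0.
  move=> t /andP[t0]; rewrite ltr_pdivlMr// => td.
  rewrite -PE; apply/f0/dl => j.
  rewrite !mxE addrAC subrr add0r normrM gtr0_norm//.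
  apply: le_lt_trans td; rewrite ler_pM2l//.
  have -> : z 0 j - y 0 j = (z - y) 0 j by rewrite !mxE.
  have S0 : 0 <= \sum_(i | i != j) `|(z - y) 0 i| by exact: sumr_ge0.
  by rewrite (bigD1 j)//=; lra.
by have := PE 1; rewrite scale1r addrC subrK P0 horner0.
Qed.

(** Separates the powers of x_4: vanishing for the heights in an interval
    gives vanishing of each coefficient. *)
Lemma poly_coef_vanish N (a : 'I_N -> R) :
  (forall t, 0 < t < 1 -> \sum_(j < N) t ^+ j * a j = 0) -> forall j, a j = 0.
Proof.
move=> a0 j; pose P : {poly R} := \poly_(i < N) (oapp a 0 (insub i)).
have P0 : P = 0.
  apply: (poly_vanish ltr01) => t t01.
  rewrite horner_poly -[RHS](a0 t t01); apply: eq_bigr => i _.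
  by rewrite valK mulrC.
have := congr1 (fun Q : {poly R} => Q`_j) P0.
by rewrite coef_poly ltn_ord valK coef0.
Qed.

End Lines.

Section Barycentric.
Variable R : realType.
Local Notation vtx := (vert R).
Local Notation grad := (grad_lam R).

Lemma dotC n (u v : 'rV[R]_n) : dot u v = dot v u.
Proof. by apply: eq_bigr => i _; rewrite mulrC. Qed.

Lemma dotDr n (u v w : 'rV[R]_n) : dot u (v + w) = dot u v + dot u w.
Proof. by rewrite -big_split; apply: eq_bigr => i _; rewrite mxE mulrDr. Qed.

Lemma dotZr n c (u v : 'rV[R]_n) : dot u (c *: v) = c * dot u v.
Proof. by rewrite mulr_sumr; apply: eq_bigr => i _; rewrite mxE mulrCA. Qed.

Lemma dot0r n (u : 'rV[R]_n) : dot u 0 = 0.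
Proof. by rewrite /dot big1// => i _; rewrite mxE mulr0. Qed.

Lemma dotBr n (u v w : 'rV[R]_n) : dot u (v - w) = dot u v - dot u w.
Proof. by rewrite -scaleN1r dotDr dotZr mulN1r. Qed.

Lemma dotDl n (u v w : 'rV[R]_n) : dot (v + w) u = dot v u + dot w u.
Proof. by rewrite !(dotC _ u) dotDr. Qed.

Lemma dotBl n (u v w : 'rV[R]_n) : dot (v - w) u = dot v u - dot w u.
Proof. by rewrite !(dotC _ u) dotBr. Qed.

Lemma dotZl n c (u v : 'rV[R]_n) : dot (c *: u) v = c * dot u v.
Proof. by rewrite !(dotC _ v) dotZr. Qed.

Lemma dot_sumr n (I : Type) (r : seq I) (u : 'rV[R]_n) (v : I -> 'rV[R]_n) :
  dot u (\sum_(i <- r) v i) = \sum_(i <- r) dot u (v i).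
Proof.
elim: r => [|i r ih]; first by rewrite !big_nil dot0r.
by rewrite !big_cons dotDr ih.
Qed.

Lemma dot_suml n (I : Type) (r : seq I) (u : 'rV[R]_n) (v : I -> 'rV[R]_n) :
  dot (\sum_(i <- r) v i) u = \sum_(i <- r) dot (v i) u.
Proof. by rewrite dotC dot_sumr; apply: eq_bigr => i _; rewrite dotC. Qed.

Lemma dot_ge0 n (u : 'rV[R]_n) : 0 <= dot u u.
Proof. by apply: sumr_ge0 => i _; rewrite -expr2 sqr_ge0. Qed.

Lemma dot_eq0 n (u : 'rV[R]_n) : dot u u = 0 -> u = 0.
Proof.
move=> u0; apply/rowP => i; rewrite mxE; apply/eqP; rewrite -sqrf_eq0 expr2.
move/eqP: u0; rewrite psumr_eq0 => [/allP /(_ i)|j _].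
  by rewrite mem_index_enum => /(_ isT).
by rewrite -expr2 sqr_ge0.
Qed.

Lemma row3P (u v : 'rV[R]_3) :
  u 0 0 = v 0 0 -> u 0 1 = v 0 1 -> u 0 2 = v 0 2 -> u = v.
Proof. by move=> *; apply/rowP; elim/ord3_ind. Qed.

Lemma grad_vert (m a b : 'I_4) :
  dot (grad m) (vtx a - vtx b) = (m == a)%:R - (m == b)%:R.
Proof. by rewrite -!(lam_vert R) dotBr /lam opprD addrACA subrr add0r. Qed.

Lemma lamD (m : 'I_4) (y z : 'rV[R]_3) : lam m (y + z) = lam m y + dot (grad m) z.
Proof. by rewrite /lam dotDr addrA. Qed.

Lemma lam_line (m a b : 'I_4) (y : 'rV[R]_3) (t : R) :
  lam m (y + t *: (vtx a - vtx b)) = lam m y + t * ((m == a)%:R - (m == b)%:R).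
Proof. by rewrite lamD dotZr grad_vert. Qed.

Lemma grad_dot_vert (m a : 'I_4) (y : 'rV[R]_3) :
  dot (grad m) (y - vtx a) = lam m y - (m == a)%:R.
Proof. by rewrite -(lam_vert R) dotBr /lam opprD addrACA subrr add0r. Qed.

Lemma lamE (y : 'rV[R]_3) :
  [/\ lam 0 y = (1 + y 0 0) / 2, lam 1 y = (1 + y 0 1) / 2,
      lam 2 y = (1 + y 0 2) / 2 & lam 3 y = - (1 + y 0 0 + y 0 1 + y 0 2) / 2].
Proof. by rewrite /lam /dot !sum3E !mxE /=; split; lra. Qed.

Lemma sum_lam (y : 'rV[R]_3) : \sum_(m < 4) lam m y = 1.
Proof. by rewrite sum4E; have [-> -> -> ->] := lamE y; lra. Qed.

Lemma sum_lam_vert (y : 'rV[R]_3) : \sum_(m < 4) lam m y *: vtx m = y.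
Proof.
rewrite sum4E; have [-> -> -> ->] := lamE y.
by apply: row3P; rewrite !mxE /=; lra.
Qed.

Lemma lam_centroid m : 0 < lam m (const_mx (- 2^-1) : 'rV[R]_3).
Proof.
have [l0 l1 l2 l3] := lamE (const_mx (- 2^-1) : 'rV[R]_3).
by elim/ord4_ind: m; rewrite ?l0 ?l1 ?l2 ?l3 !mxE; lra.
Qed.

Lemma sum_grad : \sum_(m < 4) grad m = 0.
Proof.
apply/rowP => i; rewrite sum4E !mxE /=.
by elim/ord3_ind: i => /=; lra.
Qed.

(** The upper bounds on the coordinates follow from the other inequalities. *)
Lemma T3P (y : 'rV[R]_3) : T3 y <-> forall m, 0 <= lam m y.
Proof.
rewrite /T3/= sum3E; have [l0 l1 l2 l3] := lamE y; split=> [[yi ys]|yl].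
  move: (yi 0) (yi 1) (yi 2) => ? ? ? m.
  by elim/ord4_ind: m; rewrite ?l0 ?l1 ?l2 ?l3; lra.
move: (yl 0) (yl 1) (yl 2) (yl 3); rewrite l0 l1 l2 l3 => ? ? ? ?.
by split; [elim/ord3_ind|]; lra.
Qed.

Lemma vpol_affine n m (o : 'rV[R]_m) (J : 'M[R]_(n, m)) :
  vpol 2 (fun z => o + z *m J).
Proof.
move=> i; apply: pol_ext (polD (polC _ 1 (o 0 i)) (pol_sum (index_enum _) (fun j =>
  polZ (J j i) (pol_coord R j)))) _ => z.
by rewrite !mxE; congr (_ + _); apply: eq_bigr => j _; rewrite mulrC.
Qed.

Lemma pol_lam m : pol 2 (@lam R m).
Proof.
apply: polD; first exact: polC.
apply: (@pol_dot _ _ _ 1 2); first exact: vpolC.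
exact: pol_coord.
Qed.

(** Supplies the second end of the edge along which one moves. *)
Lemma ord4_avoid (m n : 'I_4) : exists2 l, l != m & l != n.
Proof.
have [l /andP[lm ln]|no] := pickP [pred l | (l != m) && (l != n)].
  by exists l.
have := no (inord 0); have := no (inord 1); have := no (inord 2).
by rewrite /= -!val_eqE /= !inordK//; lia.
Qed.

Lemma pol_proj s (f : 'rV[R]_3 -> R) (m : 'I_4) (e : 'rV[R]_3) :
  pol s f -> pol s (fun y => f (y - lam m y *: e)).
Proof.
move=> pf; apply: (pol_comp pf) => i.
apply: pol_ext (polB (pol_coord _ i) (polZ (e 0 i) (pol_lam m))) _ => y.
by rewrite !mxE mulrC.
Qed.

(** The difference quotient of f along e with step lam_m y is a polynomial of
    one degree less.  Used with lam_m (y - lam_m y *: e) = 0, it is division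
    by lam_m with remainder the values of f on the plane lam_m = 0. *)
Lemma pol_lam_quotient s (f : 'rV[R]_3 -> R) (m : 'I_4) (e : 'rV[R]_3) :
  pol s f -> exists2 h, pol s.-1 h &
    forall y, f y = lam m y * h y + f (y - lam m y *: e).
Proof.
elim=> {s f}.
- by move=> s; exists (fun=> 0) => [|y]; [exact: pol0|rewrite mulr0 addr0].
- by move=> s c; exists (fun=> 0) => [|y]; [exact: pol0|rewrite mulr0 add0r].
- move=> s f g _ [h ph fE] _ [h' ph' gE].
  exists (fun y => h y + h' y) => [|y]; first exact: polD.
  by rewrite fE gE mulrDr addrACA.
- move=> [|s] i f pf [h ph fE].
    exists (fun=> 0) => [|y]; first exact: pol0.
    by rewrite !(pol_size0 pf) !mulr0 addr0.
  exists (fun y : 'rV[R]_3 => y 0 i * h y + e 0 i * f (y - lam m y *: e)) => [|y].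
    by apply: polD; [exact: polX|exact/polZ/pol_proj].
  rewrite {1}fE !mxE; ring.
Qed.

Lemma lam_div s (f : 'rV[R]_3 -> R) (m : 'I_4) :
  pol s f -> (forall y, lam m y = 0 -> f y = 0) ->
  exists2 h, pol s.-1 h & forall y, f y = lam m y * h y.
Proof.
move=> pf f0.
(* Along the edge from l to m the coordinate lam_m has slope 1. *)
have [l lm _] := ord4_avoid m m.
have [h ph fE] := pol_lam_quotient m (vtx m - vtx l) pf.
exists h => // y; rewrite fE f0 ?addr0//.
by rewrite -scaleNr lam_line eqxx eq_sym (negPf lm) subr0 mulr1 subrr.
Qed.

(** Cancels lam_m at y by moving along the edge from l to m.  The line stays in
    the plane of any coordinate other than these two, so that cancellation
    also works inside a face. *)
Lemma lam_cancel s (f : 'rV[R]_3 -> R) (m l : 'I_4) (y : 'rV[R]_3) :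
  l != m -> pol s f ->
  (forall t, let z := y + t *: (vtx m - vtx l) in lam m z * f z = 0) ->
  f y = 0.
Proof.
move=> lm pf f0; apply: (pol_cancel (t0 := - lam m y) (v := vtx m - vtx l) pf).
move=> t t0; have /eqP := f0 t.
rewrite /= lam_line eqxx (eq_sym m) (negPf lm) subr0 mulr1 mulf_eq0 => /orP[|/eqP//].
by rewrite addrC addr_eq0 (negPf t0).
Qed.

(** Successive division: the quotient by lam_m still vanishes on the plane of
    each other coordinate j, by cancellation along an edge direction that
    keeps lam_j. *)
Lemma lam_divs (ms : seq 'I_4) s (f : 'rV[R]_3 -> R) :
  uniq ms -> pol s f ->
  (forall m y, m \in ms -> lam m y = 0 -> f y = 0) ->
  exists2 h, pol (s - size ms) h &
    forall y, f y = (\prod_(m <- ms) lam m y) * h y.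
Proof.
elim: ms s f => [|m ms ih] s f /=.
  by move=> _ pf _; exists f => [|y]; rewrite ?subn0// big_nil mul1r.
move=> /andP[mms ums] pf f0.
have [|h ph fE] := lam_div (m := m) pf.
  by move=> y; apply: f0; rewrite mem_head.
have [|h' ph' hE] := ih _ _ ums ph.
  move=> j y jms ly; have [l lm lj] := ord4_avoid m j.
  have jm : j != m by apply: contraNneq mms => <-.
  apply: (lam_cancel lm ph) => t /=; rewrite -fE.
  apply: (f0 j); first by rewrite in_cons jms orbT.
  by rewrite lam_line (negPf jm) eq_sym (negPf lj) ly subrr mulr0 addr0.
exists h' => [|y]; last by rewrite fE hE big_cons mulrA.
by rewrite subnS -subn1 subnAC subn1.
Qed.

End Barycentric.

(** * Integrals of nonnegative polynomials *)

Section PolynomialIntegrals.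
Variable R : realType.
Local Notation leb := (@lebesgue_measure R).

Definition in_box n (M : R) (y : 'rV[R]_n) : Prop := forall i, `|y 0 i| <= M.

(** What the integral argument needs from the parameter space of a face: a
    measure that sees the coordinates of row as Lebesgue measure does, finite
    on boxes and positive near every point. *)
Definition coordinate_measure d (T : measurableType d) n
    (mu : {measure set T -> \bar R}) (row : T -> 'rV[R]_n) : Prop :=
  [/\ forall i, measurable_fun setT (fun u => row u 0 i),
      forall M, (mu [set u | in_box M (row u)] < +oo)%E
    & forall (y : 'rV[R]_n) (e : R), 0 < e -> exists B, [/\ measurable B, (0 < mu B)%E
        & forall u, B u -> forall i, `|row u 0 i - y 0 i| < e]].

Lemma snocEl n (v : 'rV[R]_n) t i : snoc v t 0 (lshift 1 i) = v 0 i.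
Proof. exact: row_mxEl. Qed.

Lemma snocEr n (v : 'rV[R]_n) t i : snoc v t 0 (rshift n i) = t.
Proof. by rewrite /snoc row_mxEr !mxE ord1. Qed.

Lemma ball_measure (y e : R) : 0 < e ->
  exists B : set R, [/\ measurable B, (0 < leb B)%E
    & forall u, B u -> `|u - y| < e].
Proof.
move=> e0; exists `]y - e, y + e[%classic; split => //.
  rewrite lebesgue_measure_itv/= lte_fin ifT; first by rewrite -EFinB lte_fin; lra.
  by lra.
by move=> u; rewrite /= in_itv/= ltr_distl.
Qed.

Lemma lebesgue_itv_lty (a b : R) : (leb `[a, b]%classic < +oo)%E.
Proof. by rewrite lebesgue_measure_itv/=; case: ifP; rewrite -?EFinB ltry. Qed.

Lemma coordinate_measure1 :
  coordinate_measure leb (fun t : R => t%:M : 'rV[R]_1).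
Proof.
split.
- move=> i; apply: (eq_measurable_fun id) => // u _.
  by rewrite !mxE ord1.
- move=> M; apply: (@le_lt_trans _ _ (leb `[- M, M]%classic)).
    apply: le_measure; rewrite ?inE//=.
  - rewrite [X in measurable X](_ : _ = `[- M, M]%classic)//.
    apply/seteqP; split=> u /=; rewrite in_itv/= -ler_norml => h.
      by have := h 0; rewrite !mxE.
    by move=> i; rewrite !mxE ord1.
  - by move=> u /= /(_ 0); rewrite !mxE in_itv/= -ler_norml.
  exact: lebesgue_itv_lty.
- move=> y e e0; have [B [mB B0 By]] := ball_measure (y 0 0) e0.
  by exists B; split=> // u Bu i; rewrite !ord1 !mxE; exact: By.
Qed.

Lemma measurable_box d (T : measurableType d) n (row : T -> 'rV[R]_n) M :
  (forall i, measurable_fun setT (fun u => row u 0 i)) ->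
  measurable [set u | in_box M (row u)].
Proof.
move=> mrow.
rewrite [X in measurable X](_ : _ =
    \bigcap_(i in [set: 'I_n]) ((fun u => row u 0 i) @^-1` `[- M, M]%classic)).
  apply: fin_bigcap_measurable => // i _.
  by rewrite -[X in measurable X]setTI; exact: mrow.
apply/seteqP; split=> u /= h i; first by move=> _; rewrite /= in_itv/= -ler_norml.
by have := h i I; rewrite /= in_itv/= -ler_norml.
Qed.

(** The parameter measures are iterated products with Lebesgue measure on the
    right, matching the way in which row vectors are built. *)
Lemma coordinate_measure_snoc d (T : measurableType d) n
    (mu : {measure set T -> \bar R}) (row : T -> 'rV[R]_n) :
  coordinate_measure mu row ->
  coordinate_measure (mu \x leb)%E (fun u : T * R => snoc (row u.1) u.2).
Proof.
move=> [mrow frow brow]; split.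
- move=> i; case: (split_ordP i) => j ->.
    apply: (eq_measurable_fun ((fun u => row u 0 j) \o fst)) => [u _ /=|].
      by rewrite snocEl.
    exact: measurableT_comp (mrow j) measurable_fst.
  apply: (eq_measurable_fun snd) => [u _ /=|]; first by rewrite snocEr.
  exact: measurable_snd.
- move=> M.
  set A := [set u | in_box M (row u)].
  rewrite [X in (_ X < _)%E](_ : _ = A `*` `[- M, M]%classic).
    have mA : measurable A by exact: measurable_box.
    rewrite [X in (X < _)%E](product_measure1E mu leb mA)//.
    apply: lte_mul_pinfty => //; last exact: lebesgue_itv_lty.
    by rewrite ge0_fin_numE// frow.
  apply/seteqP; split=> -[u t] /= h.
    split=> [i|]; first by have := h (lshift 1 i); rewrite snocEl.
    by have := h (rshift n ord0); rewrite snocEr in_itv/= -ler_norml.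
  move=> i; case: (split_ordP i) => j ->.
    by rewrite snocEl; exact: h.1.
  by have := h.2; rewrite /= in_itv/= -ler_norml snocEr.
- move=> y e e0.
  have [A [mA A0 Ay]] := brow (\row_i y 0 (lshift 1 i)) e e0.
  have [B [mB B0 By]] := ball_measure (y 0 (rshift n ord0)) e0.
  exists (A `*` B); split.
  - exact: measurableX.
  - by rewrite [X in (_ < X)%E](product_measure1E mu leb mA mB) mule_gt0.
  - move=> [u t] [/= Au Bt] i; case: (split_ordP i) => j ->.
      by rewrite snocEl; have := Ay u Au j; rewrite mxE.
    by rewrite snocEr !ord1; exact: By.
Qed.

Lemma measurable_pol d (T : measurableType d) n (row : T -> 'rV[R]_n) s f :
  (forall i, measurable_fun setT (fun u => row u 0 i)) ->
  pol s f -> measurable_fun setT (fun u => f (row u)).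
Proof.
move=> mrow; elim=> {s f}.
- by move=> s; exact: measurable_cst.
- by move=> s c; exact: measurable_cst.
- by move=> s f g _ mf _ mg; exact: measurable_funD.
- by move=> s i f _ mf; exact: measurable_funM.
Qed.

Lemma pol_bounded n s (f : 'rV[R]_n -> R) (M : R) : pol s f ->
  exists2 C, 0 <= C & forall y, in_box M y -> `|f y| <= C.
Proof.
elim=> {s f}.
- by move=> s; exists 0 => // y _; rewrite normr0.
- by move=> s c; exists `|c|.
- move=> s f g _ [C C0 fC] _ [D D0 gD]; exists (C + D) => [|y yM].
    exact: addr_ge0.
  by rewrite (le_trans (ler_normD _ _))// lerD ?fC ?gD.
- move=> s i f _ [C C0 fC]; exists (`|M| * C) => [|y yM].
    by rewrite mulr_ge0.
  by rewrite normrM ler_pM ?fC// (le_trans (yM i)) ?ler_norm.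
Qed.

(** If f z <> 0 at an interior point z, then f has a constant sign near z,
    which contradicts f >= 0 or makes the integral positive.  Boundedness
    keeps the integral finite: otherwise its real value would be 0. *)
Lemma integral_pol_eq0 d (T : measurableType d) n
    (mu : {measure set T -> \bar R}) (row : T -> 'rV[R]_n)
    (I : finType) (l : I -> 'rV[R]_n -> R) s s' (f : 'rV[R]_n -> R)
    (D : set T) (M : R) (y : 'rV[R]_n) :
  coordinate_measure mu row ->
  (forall i, pol s (l i)) -> pol s' f ->
  (forall u, D u <-> forall i, 0 <= l i (row u)) ->
  (forall u, D u -> in_box M (row u)) ->
  (forall i, 0 < l i y) ->
  (forall u, D u -> 0 <= f (row u)) ->
  \int[mu]_(u in D) f (row u) = 0 ->
  forall z, f z = 0.
Proof.
move=> [mrow frow brow] pl pf DE DM ly f0 int0.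
apply: (pol_identity pl ly pf) => z lz.
have [e e0 ez] := pos_region_nbhd pl lz.
have mD : measurable D.
  rewrite [X in measurable X](_ : _ = \bigcap_(i in [set: I])
      ((fun u => l i (row u)) @^-1` `[0, +oo[%classic)).
    apply: fin_bigcap_measurable => // i _.
    by rewrite -[X in measurable X]setTI; exact: (measurable_pol mrow (pl i)).
  apply/seteqP; split=> u.
    by move=> /DE h i _; rewrite /= in_itv/= andbT.
  by move=> h; apply/DE => i; have := h i Logic.I; rewrite /= in_itv/= andbT.
have [fz|fz|//] := ltrgtP (f z) 0; last first.
  have [e' e'0 fe'] := pol_gt0_nbhd pf fz.
  have [B [mB B0 Bz]] := brow z (Num.min e e') (ltac:(by rewrite lt_min e0)).
  have BD : B `<=` D.
    move=> u Bu; apply/DE => i; apply/ltW/ez => j.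
    by rewrite (lt_le_trans (Bz _ Bu _))// ge_min lexx.
  have mf : measurable_fun setT (fun u => f (row u)).
    exact: measurable_pol pf.
  have mfE A : measurable_fun A (fun u => (f (row u))%:E).
    by apply/measurable_EFinP; exact: measurable_funTS.
  have [C C0 fC] := pol_bounded M pf.
  (* Rules out the infinite value, which the real-valued integral sends to 0. *)
  have intfin : (\int[mu]_(u in D) (f (row u))%:E \is a fin_num)%E.
    rewrite ge0_fin_numE; last by apply: integral_ge0 => u Du; rewrite lee_fin f0.
    apply: (@le_lt_trans _ _ (\int[mu]_(u in D) C%:E)%E).
      apply: ge0_le_integral => //.
      by move=> u Du; rewrite lee_fin (le_trans (ler_norm _))// fC//; exact: DM.
    rewrite integral_cst//; apply: lte_mul_pinfty => //.
    apply: le_lt_trans (frow M); apply: le_measure; rewrite ?inE//.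
    exact: measurable_box.
  have : (\int[mu]_(u in D) (f (row u))%:E = 0)%E.
    by rewrite -(fineK intfin); move: int0; rewrite /Rintegral => ->.
  move=> int0E; exfalso.
  suff : (0 < \int[mu]_(u in D) (f (row u))%:E)%E by rewrite int0E ltxx.
  apply: (@lt_le_trans _ _ (\int[mu]_(u in B) (f z / 2)%:E)%E).
    rewrite integral_cst// mule_gt0// lte_fin; lra.
  apply: (@le_trans _ _ (\int[mu]_(u in B) (f (row u))%:E)%E).
    apply: ge0_le_integral => //.
    - by move=> u _; rewrite lee_fin; lra.
    - move=> u Bu; rewrite lee_fin ltW// fe'// => j.
      by rewrite (lt_le_trans (Bz _ Bu _))// ge_min lexx orbT.
  apply: ge0_subset_integral => // u Du; rewrite lee_fin f0//.
have pg := polZ (-1) pf; have gz : 0 < -1 * f z by rewrite mulN1r oppr_gt0.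
have [e' e'0 fe'] := pol_gt0_nbhd pg gz.
have [B [mB B0 Bz]] := brow z (Num.min e e') (ltac:(by rewrite lt_min e0)).
have [u Bu] : B !=set0.
  by apply/set0P; apply: contraTneq B0 => ->; rewrite measure0 ltxx.
have Du : D u.
  apply/DE => i; apply/ltW/ez => j.
  by rewrite (lt_le_trans (Bz _ Bu _))// ge_min lexx.
have := f0 u Du; have := fe' (row u).
have Bu' j : `|row u 0 j - z 0 j| < e'.
  by rewrite (lt_le_trans (Bz _ Bu _))// ge_min lexx orbT.
by move=> /(_ Bu'); lra.
Qed.

Lemma coordinate_measure_row2 : coordinate_measure (leb \x leb)%E (@row2 R).
Proof. exact: coordinate_measure_snoc coordinate_measure1. Qed.

Lemma coordinate_measure_row3 :
  coordinate_measure ((leb \x leb) \x leb)%E (@row3 R).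
Proof. exact: coordinate_measure_snoc coordinate_measure_row2. Qed.

Lemma coordinate_measure_row4 :
  coordinate_measure (((leb \x leb) \x leb) \x leb)%E (@row4 R).
Proof. exact: coordinate_measure_snoc coordinate_measure_row3. Qed.

End PolynomialIntegrals.

(** * The trace of a 2-form in vector notation *)

Section Traces.
Variable R : realType.
Local Notation vtx := (vert R).
Local Notation grad := (grad_lam R).

Lemma dot3E (u v : 'rV[R]_3) :
  dot u v = u 0 0 * v 0 0 + u 0 1 * v 0 1 + u 0 2 * v 0 2.
Proof. exact: sum3E. Qed.

Lemma crossE (u v : 'rV[R]_3) :
  [/\ cross u v 0 0 = u 0 1 * v 0 2 - u 0 2 * v 0 1,
      cross u v 0 1 = u 0 2 * v 0 0 - u 0 0 * v 0 2
    & cross u v 0 2 = u 0 0 * v 0 1 - u 0 1 * v 0 0].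
Proof.
by split; rewrite mxE; congr (u 0 _ * v 0 _ - u 0 _ * v 0 _); exact: val_inj.
Qed.

Lemma cross_lagrange (a u v : 'rV[R]_3) :
  dot (cross a u) (cross a v) = dot a a * dot u v - dot a u * dot a v.
Proof.
have [c0 c1 c2] := crossE a u; have [d0 d1 d2] := crossE a v.
by rewrite !dot3E c0 c1 c2 d0 d1 d2; ring.
Qed.

Lemma dot_cross_self (a u : 'rV[R]_3) : dot a (cross a u) = 0.
Proof. by have [c0 c1 c2] := crossE a u; rewrite dot3E c0 c1 c2; ring. Qed.

Lemma xyz_pt (y : 'rV[R]_3) t : xyz (pt y t) = y.
Proof. exact: row_mxKl. Qed.

Lemma ptEl (y : 'rV[R]_3) t (i : 'I_3) : pt y t 0 (lshift 1 i) = y 0 i.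
Proof. exact: snocEl. Qed.

Lemma xyzE (x : 'rV[R]_4) :
  [/\ xyz x 0 0 = x 0 0, xyz x 0 1 = x 0 1 & xyz x 0 2 = x 0 2].
Proof. by split; rewrite mxE; congr (x 0 _); exact: val_inj. Qed.

Lemma heightE (x : 'rV[R]_4) : height x = x 0 (rshift 3 ord0).
Proof. by congr (x 0 _); exact: val_inj. Qed.

Lemma height_pt (y : 'rV[R]_3) t : height (pt y t) = t.
Proof. by rewrite heightE [LHS]snocEr. Qed.

Lemma pt_xyz (x : 'rV[R]_4) : pt (xyz x) (height x) = x.
Proof.
apply/rowP => i; case: (@split_ordP 3 1 i) => j ->.
  by rewrite [LHS]snocEl mxE.
by rewrite ord1 -!heightE height_pt.
Qed.

Lemma xyzD (x z : 'rV[R]_4) : xyz (x + z) = xyz x + xyz z.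
Proof. exact: linearD. Qed.

Lemma xyzZ a (x : 'rV[R]_4) : xyz (a *: x) = a *: xyz x.
Proof. exact: linearZ. Qed.

Lemma heightD (x z : 'rV[R]_4) : height (x + z) = height x + height z.
Proof. by rewrite /height mxE. Qed.

Lemma heightZ a (x : 'rV[R]_4) : height (a *: x) = a * height x.
Proof. by rewrite /height mxE. Qed.

Lemma ptD (y z : 'rV[R]_3) t s : pt y t + pt z s = pt (y + z) (t + s).
Proof. by rewrite -[LHS]pt_xyz xyzD heightD !xyz_pt !height_pt. Qed.

Lemma ptZ a (y : 'rV[R]_3) t : a *: pt y t = pt (a *: y) (a * t).
Proof. by rewrite -[LHS]pt_xyz xyzZ heightZ !xyz_pt !height_pt. Qed.

Lemma ptB (y z : 'rV[R]_3) t s : pt y t - pt z s = pt (y - z) (t - s).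
Proof. by rewrite -scaleN1r ptZ ptD scaleN1r mulN1r. Qed.

Lemma dot_pt (y z : 'rV[R]_3) t s : dot (pt y t) (pt z s) = dot y z + t * s.
Proof.
rewrite /dot (@big_split_ord _ _ _ 3 1) /= big_ord1.
congr (_ + _); first by apply: eq_bigr => i _; rewrite !ptEl.
by rewrite -!heightE !height_pt.
Qed.

Lemma dot4E (u v : 'rV[R]_4) : dot u v = dot (xyz u) (xyz v) + height u * height v.
Proof. by rewrite -dot_pt !pt_xyz. Qed.

Let levi_civitaZ (i j k l : 'I_4) : int :=
  sgz (j%:Z - i%:Z) * sgz (k%:Z - i%:Z) * sgz (l%:Z - i%:Z)
   * sgz (k%:Z - j%:Z) * sgz (l%:Z - j%:Z) * sgz (l%:Z - k%:Z).

(** Separating the vertical index from the three horizontal ones turns the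
    four-dimensional Levi-Civita symbol into the three-dimensional one. *)
Lemma trace2E (n p w : 'rV[R]_3) (m : R) :
  trace2 (pt n m) (skewN p + skewRT w) =
  2 *: pt (cross n p + m *: w) (- dot n w).
Proof.
have n3 : pt n m 0 3 = m := height_pt n m.
have nl (i : 'I_3) : pt n m 0 (lshift 1 i) = n 0 i by exact: snocEl.
have n0 : pt n m 0 0 = n 0 0 by rewrite -nl; congr (pt n m 0 _); exact: val_inj.
have n1 : pt n m 0 1 = n 0 1 by rewrite -nl; congr (pt n m 0 _); exact: val_inj.
have n2 : pt n m 0 2 = n 0 2 by rewrite -nl; congr (pt n m 0 _); exact: val_inj.
(* The sign is computed on integers, where it reduces for concrete indices. *)
have lcE i j k l : levi_civita R i j k l = (levi_civitaZ i j k l)%:~R by [].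
have comp i : trace2 (pt n m) (skewN p + skewRT w) 0 i =
   \sum_(j < 4) \sum_(k < 4) \sum_(l < 4) (levi_civitaZ i j k l)%:~R * pt n m 0 j *
      (skewN p k l + skewRT w k l).
  rewrite mxE; apply: eq_bigr => j _; apply: eq_bigr => k _; apply: eq_bigr => l _.
  by rewrite lcE; congr (_ * _); rewrite mxE.
have [c0 c1 c2] := crossE n p.
have skewNE k l : skewN p k l = nth 0 (nth [::]
    [:: [:: 0; 0; 0; p 0 0]; [:: 0; 0; 0; p 0 1]; [:: 0; 0; 0; p 0 2];
        [:: - p 0 0; - p 0 1; - p 0 2; 0]] k) l.
  by rewrite mxE; elim/ord4_ind: k; elim/ord4_ind: l; rewrite /= ?oppr0.
have skewRTE k l : skewRT w k l = nth 0 (nth [::]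
    [:: [:: 0; w 0 2; - w 0 1; 0]; [:: - w 0 2; 0; w 0 0; 0];
        [:: w 0 1; - w 0 0; 0; 0]; [:: 0; 0; 0; 0]] k) l.
  by rewrite mxE; elim/ord4_ind: k; elim/ord4_ind: l; rewrite /= ?oppr0 ?opprK.
have [x0 x1 x2] := xyzE (trace2 (pt n m) (skewN p + skewRT w)).
have compE i : trace2 (pt n m) (skewN p + skewRT w) 0 i =
    2 * nth 0 [:: n 0 1 * p 0 2 - n 0 2 * p 0 1 + m * w 0 0;
                  n 0 2 * p 0 0 - n 0 0 * p 0 2 + m * w 0 1;
                  n 0 0 * p 0 1 - n 0 1 * p 0 0 + m * w 0 2;
                  - (n 0 0 * w 0 0 + n 0 1 * w 0 1 + n 0 2 * w 0 2)] i.
{ rewrite comp sum4E n0 n1 n2 n3 !sum4E !skewNE !skewRTE /=.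
  elim/ord4_ind: i => /=.
  all: repeat match goal with |- context [levi_civitaZ ?a ?b ?c ?d] =>
    let v := eval vm_compute in (levi_civitaZ a b c d) in
    change (levi_civitaZ a b c d) with v end.
  all: ring. }
rewrite -[LHS]pt_xyz ptZ; congr pt.
  apply: row3P; rewrite ?x0 ?x1 ?x2 compE /= mxE mxE ?c0 ?c1 ?c2;
  by congr (_ * (_ + _)); rewrite mxE.
by rewrite /height compE /= dot3E.
Qed.

End Traces.

(** * Normals and conormals of facets and faces *)

Section Normals.
Variable R : realType.
Local Notation vtx := (vert R).
Local Notation grad := (grad_lam R).

Lemma vert_sub3 (d : 'rV[R]_3) :
  [/\ dot d (vtx 0 - vtx 3) = 2 * d 0 0, dot d (vtx 1 - vtx 3) = 2 * d 0 1
    & dot d (vtx 2 - vtx 3) = 2 * d 0 2].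
Proof. by split; rewrite dot3E !mxE /=; ring. Qed.

(** The edge directions from one vertex span the space. *)
Lemma dot_vert_eq0 (d : 'rV[R]_3) (m : 'I_4) :
  (forall a, dot d (vtx a - vtx m) = 0) -> d = 0.
Proof.
move=> d0; have d3 a : dot d (vtx a - vtx 3) = 0.
  by rewrite -[vtx a](subrK (vtx m)) -addrA dotDr d0 add0r -opprB -scaleN1r dotZr
    d0 mulr0.
have [e0 e1 e2] := vert_sub3 d; move: (d3 0) (d3 1) (d3 2).
by rewrite e0 e1 e2 => ? ? ?; apply: row3P; rewrite mxE; lra.
Qed.

Lemma T3_vert a : T3 (vtx a).
Proof. by apply/T3P => m; rewrite lam_vert ler0n. Qed.

Lemma triangle_vert (m a : 'I_4) : a != m -> triangle m (vtx a).
Proof. by move=> am; split; [exact: T3_vert|rewrite lam_vert eq_sym (negPf am)]. Qed.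

(** A normal u minus its multiple of the gradient is orthogonal to the edge
    leaving the triangle as well. *)
Lemma normal_triangleP (m : 'I_4) (u : 'rV[R]_3) :
  normal_to (triangle m) u <-> exists a, u = a *: grad m.
Proof.
split=> [nu|[a ->] y z [_ y0] [_ z0]]; last first.
  rewrite dotZl (_ : dot _ _ = 0) ?mulr0//.
  have : lam m (z + (y - z)) = 0 by rewrite addrC subrK.
  by rewrite lamD z0 add0r.
have [b bm _] := ord4_avoid m m.
exists (dot u (vtx m - vtx b)); apply/eqP; rewrite -subr_eq0; apply/eqP.
apply: (@dot_vert_eq0 _ b) => a; rewrite dotBl dotZl grad_vert.
rewrite [m == b]eq_sym (negPf bm) subr0; have [->|ma] := eqVneq m a.
  by rewrite mulr1 subrr.
by rewrite mulr0 subr0 nu//; apply: triangle_vert; rewrite // eq_sym.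
Qed.

Lemma T1_0 : T1 (0 : R).
Proof. by rewrite /T1/=; lra. Qed.

Lemma normal_TetP b (n : 'rV[R]_4) :
  normal_to (facet_set (Tet b)) n <-> exists a, n = pt 0 a.
Proof.
split=> [nn|[a ->] x z [_ hx] [_ hz]]; last first.
  rewrite -(pt_xyz (x - z)) dot_pt dotC dot0r add0r.
  by rewrite /height !mxE -!/(height _) hx hz subrr mulr0.
exists (height n); rewrite -{1}[n]pt_xyz; congr pt.
apply: (@dot_vert_eq0 _ 3) => a.
have := nn (pt (vtx a) (endpoint R b)) (pt (vtx 3) (endpoint R b)).
rewrite -{1}[n]pt_xyz ptB dot_pt subrr mulr0 addr0; apply;
  by split; rewrite ?xyz_pt ?height_pt//; exact: T3_vert.
Qed.

Lemma normal_PrismP m (n : 'rV[R]_4) :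
  normal_to (facet_set (Prism m)) n <-> exists a, n = pt (a *: grad m) 0.
Proof.
split=> [nn|[a ->] x z [tx hx] [tz hz]]; last first.
  rewrite -(pt_xyz (x - z)) dot_pt mul0r addr0 xyzD -scaleN1r xyzZ scaleN1r.
  by apply: (normal_triangleP m _).2 => //; exists a.
have [a na] : exists a, xyz n = a *: grad m.
  apply/(normal_triangleP m) => y z ty tz.
  have := nn (pt y 0) (pt z 0).
  rewrite -{1}[n]pt_xyz ptB dot_pt subrr mulr0 addr0; apply;
    by split; rewrite ?xyz_pt ?height_pt//; exact: T1_0.
exists a; rewrite -[n]pt_xyz na; congr pt.
have [b bm _] := ord4_avoid m m.
have := nn (pt (vtx b) 1) (pt (vtx b) 0).
rewrite -{1}[n]pt_xyz ptB dot_pt !subrr dot0r add0r subr0 mulr1.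
have tb t : T1 t -> facet_set (Prism m) (pt (vtx b) t).
  by split; rewrite ?xyz_pt ?height_pt//; exact: triangle_vert.
by apply; apply: tb; rewrite /T1/=; lra.
Qed.

Variable c : face_choice R.

Lemma unit_normal_Tet b : exists2 a, a != 0 & unit_normal c (Tet b) = pt 0 a.
Proof.
have [/normal_TetP[a na] n1] := unit_normalP c (Tet b).
exists a => //; apply: contra_eq_neq n1 => a0.
by rewrite na a0 dot_pt dot0r mulr0 addr0 eq_sym oner_eq0.
Qed.

Lemma unit_normal_Prism m :
  exists2 a, a != 0 & unit_normal c (Prism m) = pt (a *: grad m) 0.
Proof.
have [/normal_PrismP[a na] n1] := unit_normalP c (Prism m).
exists a => //; apply: contra_eq_neq n1 => a0.
by rewrite na a0 scale0r dot_pt dot0r mulr0 addr0 eq_sym oner_eq0.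
Qed.

Lemma facet_trace_Tet b : exists2 a, a != 0 & forall F x p w,
  F x = skewN p + skewRT w -> facet_trace c (Tet b) F x = a *: pt w 0.
Proof.
have [a a0 na] := unit_normal_Tet b.
exists (2 * a) => [|F x p w Fx]; first by rewrite mulf_neq0// pnatr_eq0.
rewrite /facet_trace na Fx trace2E -scalerA; congr (_ *: _).
rewrite ptZ mulr0; congr pt; last by rewrite dotC dot0r oppr0.
have [c0 c1 c2] := crossE 0 p.
by apply: row3P; rewrite mxE ?c0 ?c1 ?c2 !mxE; ring.
Qed.

Lemma facet_trace_Prism m : exists2 a, a != 0 & forall F x p w,
  F x = skewN p + skewRT w ->
  facet_trace c (Prism m) F x = a *: pt (cross (grad m) p) (- dot (grad m) w).
Proof.
have [a a0 na] := unit_normal_Prism m.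
exists (2 * a) => [|F x p w Fx]; first by rewrite mulf_neq0// pnatr_eq0.
rewrite /facet_trace na Fx trace2E -scalerA; congr (_ *: _).
rewrite ptZ scale0r addr0; congr pt; last by rewrite dotZl mulrN.
have [c0 c1 c2] := crossE (grad m) p; have [d0 d1 d2] := crossE (a *: grad m) p.
by apply: row3P; rewrite ?d0 ?d1 ?d2 [in RHS]mxE ?c0 ?c1 ?c2 !mxE; ring.
Qed.

(** Only the two facets that contain a face can host it; a vertex of the face
    or its height excludes the others. *)
Lemma host_Tri m b : host c (Tri m b) = Tet b \/ host c (Tri m b) = Prism m.
Proof.
have := @hostP _ c (Tri m b); case: (host c (Tri m b)) => [b'|m'] sub.
  left; congr Tet; have [a am _] := ord4_avoid m m.
  have [] := sub (pt (vtx a) (endpoint R b)).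
    by split; rewrite ?xyz_pt ?height_pt//; exact: triangle_vert.
  by rewrite height_pt => _; case: b {sub} => //=; case: b' => //=; lra.
right; congr Prism; apply/eqP; apply: contraT => mm'.
have [] := sub (pt (vtx m') (endpoint R b)).
  by split; rewrite ?xyz_pt ?height_pt//; exact: triangle_vert.
by move=> -[_]; rewrite xyz_pt lam_vert eqxx => /eqP; rewrite oner_eq0.
Qed.

Lemma edge_vert (i j : 'I_4) : edge i j (vtx i) /\ edge i j (vtx j).
Proof.
by split; split; try exact: T3_vert; move=> m mi mj; rewrite lam_vert ?(negPf mi)
  ?(negPf mj).
Qed.

Lemma host_Quad (i j : 'I_4) (ij : (i < j)%N) : exists m,
  [/\ host c (Quad ij) = Prism m, m != i & m != j].
Proof.
have [ei ej] := edge_vert i j.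
have := @hostP _ c (Quad ij); case: (host c (Quad ij)) => [b'|m'] sub.
  have [] := sub (pt (vtx i) 0).
    by split; rewrite ?xyz_pt ?height_pt//; exact: T1_0.
  by rewrite height_pt; case: b' {sub} => /=; lra.
exists m'; split=> //; apply/negP => /eqP mE.
  have [] := sub (pt (vtx i) 0).
    by split; rewrite ?xyz_pt ?height_pt//; exact: T1_0.
  by case=> _; rewrite xyz_pt lam_vert mE eqxx => /eqP; rewrite oner_eq0.
have [] := sub (pt (vtx j) 0).
  by split; rewrite ?xyz_pt ?height_pt//; exact: T1_0.
by case=> _; rewrite xyz_pt lam_vert mE eqxx => /eqP; rewrite oner_eq0.
Qed.

Lemma normal_Tri m b (v : 'rV[R]_4) : normal_to (face_set (Tri m b)) v ->
  exists a, xyz v = a *: grad m.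
Proof.
move=> nv; apply/(normal_triangleP m) => y z ty tz.
have := nv (pt y (endpoint R b)) (pt z (endpoint R b)).
rewrite -{1}[v]pt_xyz ptB dot_pt subrr mulr0 addr0; apply;
  by split; rewrite ?xyz_pt ?height_pt.
Qed.

Lemma grad_neq0 m : dot (grad m) (grad m) != 0.
Proof.
apply/eqP => /dot_eq0 g0; have [l lm _] := ord4_avoid m m.
have := grad_vert R m m l; rewrite g0 dotC dot0r eqxx [m == l]eq_sym (negPf lm).
by rewrite subr0 => /esym/eqP; rewrite oner_eq0.
Qed.

(** Whichever facet hosts the face, the conormal selects the component of w
    normal to the triangle: hosted by a base the conormal is horizontal,
    hosted by a prism it is vertical. *)
Lemma face_trace_Tri m b : exists2 a, a != 0 & forall F x p w,
  F x = skewN p + skewRT w -> face_trace c (Tri m b) F x = a * dot (grad m) w.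
Proof.
have [tv nv v1] := unit_conormalP c (Tri m b).
have [a va] := normal_Tri nv.
rewrite /face_trace; case: (host_Tri m b) => hE; rewrite hE in tv *.
- have v3 : height (unit_conormal c (Tri m b)) = 0.
    have := tv (pt 0 1); rewrite dot4E xyz_pt height_pt dotC dot0r add0r mul1r.
    by apply; apply/normal_TetP; exists 1.
  have a0 : a != 0.
    apply: contra_eq_neq v1 => a0.
    by rewrite dot4E v3 va a0 scale0r dot0r mulr0 addr0 eq_sym oner_eq0.
  have [a' a'0 trE] := facet_trace_Tet b.
  exists (a' * a) => [|F x p w Fx]; first by rewrite mulf_neq0.
  rewrite (trE _ _ _ _ Fx) dotZl dot4E v3 mulr0 addr0 xyz_pt va dotZr dotC.
  by rewrite mulrA.
- have va0 : xyz (unit_conormal c (Tri m b)) = 0.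
    have := tv (pt (grad m) 0); rewrite dot4E xyz_pt height_pt va dotZr mul0r addr0.
    have ng : normal_to (facet_set (Prism m)) (pt (grad m) 0).
      by apply/normal_PrismP; exists 1; rewrite scale1r.
    by move=> /(_ ng)/eqP; rewrite mulf_eq0 (negPf (grad_neq0 m)) orbF => /eqP ->;
      rewrite scale0r.
  set v3 := height (unit_conormal c (Tri m b)).
  have v30 : v3 != 0.
    apply: contra_eq_neq v1 => v30.
    by rewrite dot4E va0 dot0r -/v3 v30 mulr0 addr0 eq_sym oner_eq0.
  have [a' a'0 trE] := facet_trace_Prism m.
  exists (- (a' * v3)) => [|F x p w Fx]; first by rewrite oppr_eq0 mulf_neq0.
  rewrite (trE _ _ _ _ Fx) dotZl dot4E va0 dot0r add0r height_pt -/v3; ring.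
Qed.

(** A cross product of two vectors orthogonal to t is parallel to t, because
    t x (a x b) = (b.t) a - (a.t) b. *)
Lemma cross_orthogonal (a b t : 'rV[R]_3) :
  dot a t = 0 -> dot b t = 0 ->
  dot t t *: cross a b = dot (cross a b) t *: t.
Proof.
move=> at0 bt0; have [c0 c1 c2] := crossE a b.
set u := cross a b in c0 c1 c2 *.
have e2 : t 0 0 * u 0 1 - t 0 1 * u 0 0 = dot b t * a 0 2 - dot a t * b 0 2.
  by rewrite !dot3E c0 c1; ring.
have e0 : t 0 1 * u 0 2 - t 0 2 * u 0 1 = dot b t * a 0 0 - dot a t * b 0 0.
  by rewrite !dot3E c2 c1; ring.
have e1 : t 0 2 * u 0 0 - t 0 0 * u 0 2 = dot b t * a 0 1 - dot a t * b 0 1.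
  by rewrite !dot3E c0 c2; ring.
rewrite at0 bt0 !mul0r subrr in e0 e1 e2.
apply: row3P; rewrite [LHS]mxE [RHS]mxE !dot3E; apply/eqP; rewrite -subr_eq0;
  apply/eqP.
- transitivity (t 0 2 * (t 0 2 * u 0 0 - t 0 0 * u 0 2)
    - t 0 1 * (t 0 0 * u 0 1 - t 0 1 * u 0 0)); first by ring.
  by rewrite e1 e2 !mulr0 subrr.
- transitivity (t 0 0 * (t 0 0 * u 0 1 - t 0 1 * u 0 0)
    - t 0 2 * (t 0 1 * u 0 2 - t 0 2 * u 0 1)); first by ring.
  by rewrite e0 e2 !mulr0 subrr.
- transitivity (t 0 1 * (t 0 1 * u 0 2 - t 0 2 * u 0 1)
    - t 0 0 * (t 0 2 * u 0 0 - t 0 0 * u 0 2)); first by ring.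
  by rewrite e1 e0 !mulr0 subrr.
Qed.

Lemma dot_cross (a b : 'rV[R]_3) :
  dot (cross a b) (cross a b) = dot a a * dot b b - dot a b ^+ 2.
Proof. by have [c0 c1 c2] := crossE a b; rewrite !dot3E c0 c1 c2; ring. Qed.

Lemma triple_product (a b p : 'rV[R]_3) :
  dot (cross b p) a = dot p (cross a b).
Proof.
have [c0 c1 c2] := crossE a b; have [d0 d1 d2] := crossE b p.
by rewrite !dot3E c0 c1 c2 d0 d1 d2; ring.
Qed.

(** The conormal v is horizontal and orthogonal both to the edge and to the
    facet normal g, so (g x p).v = p.(v x g) with v x g along the edge. *)
Lemma face_trace_Quad (i j : 'I_4) (ij : (i < j)%N) :
  exists2 a, a != 0 & forall F x p w,
  F x = skewN p + skewRT w ->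
  face_trace c (Quad ij) F x = a * dot p (vtx j - vtx i).
Proof.
have [tv nv v1] := unit_conormalP c (Quad ij).
have [m [hE mi mj]] := host_Quad ij.
rewrite /face_trace; rewrite hE in tv *.
set v := unit_conormal c (Quad ij) in tv nv v1 *; set t := vtx j - vtx i.
have [ei ej] := edge_vert i j.
have v3 : height v = 0.
  have := nv (pt (vtx i) 1) (pt (vtx i) 0).
  rewrite -{1}[v]pt_xyz ptB dot_pt !subrr dot0r add0r subr0 mulr1; apply;
    by split; rewrite ?xyz_pt ?height_pt// /T1/=; lra.
have vt : dot (xyz v) t = 0.
  have := nv (pt (vtx j) 0) (pt (vtx i) 0).
  rewrite -{1}[v]pt_xyz ptB dot_pt subrr mulr0 addr0; apply;
    by split; rewrite ?xyz_pt ?height_pt// /T1/=; lra.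
have vg : dot (xyz v) (grad m) = 0.
  have := tv (pt (grad m) 0); rewrite dot4E xyz_pt height_pt mul0r addr0 dotC.
  by apply; apply/normal_PrismP; exists 1; rewrite scale1r.
have gt : dot (grad m) t = 0 by rewrite grad_vert (negPf mi) (negPf mj) subrr.
have tt0 : dot t t != 0.
  apply/eqP => /dot_eq0 t0; have := grad_vert R j j i; rewrite -/t t0 dot0r eqxx.
  have ji : (j == i) = false by rewrite eq_sym -val_eqE ltn_eqF.
  by rewrite ji subr0 => /esym/eqP; rewrite oner_eq0.
have cE := cross_orthogonal vt gt.
set k := dot (cross (xyz v) (grad m)) t in cE.
have k0 : k != 0.
  apply/eqP => k0.
  have c0 : cross (xyz v) (grad m) = 0.
    by apply/eqP; move/eqP: cE; rewrite k0 scale0r scaler_eq0 (negPf tt0).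
  have := dot_cross (xyz v) (grad m); rewrite c0 dot0r vg expr0n subr0.
  move: v1; rewrite dot4E v3 mulr0 addr0 => -> /esym/eqP.
  by rewrite mul1r (negPf (grad_neq0 m)).
have [a' a'0 trE] := facet_trace_Prism m.
exists (a' * (k / dot t t)) => [|F x p w Fx].
  by rewrite !mulf_neq0// invr_eq0.
rewrite (trE _ _ _ _ Fx) dotZl dot4E v3 mulr0 addr0 xyz_pt triple_product -mulrA.
congr (_ * _); apply: (mulfI tt0).
by rewrite -(dotZr (dot t t) p) cE dotZr mulrA [dot t t * _]mulrC divfK.
Qed.

End Normals.

(** * Coefficients in the fourth variable *)

Section Decomposition.
Variable R : realType.

Lemma skewN_linear (a : R) p q : skewN (a *: p + q) = a *: skewN p + skewN q.
Proof.
apply/matrixP => i j; rewrite !mxE.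
by elim/ord4_ind: i; elim/ord4_ind: j => /=; ring.
Qed.

Lemma skewRT_linear (a : R) p q : skewRT (a *: p + q) = a *: skewRT p + skewRT q.
Proof.
apply/matrixP => i j; rewrite !mxE.
by elim/ord4_ind: i; elim/ord4_ind: j => /=; ring.
Qed.

HB.instance Definition _ :=
  GRing.isLinear.Build R 'rV[R]_3 'M[R]_4 *:%R (@skewN R) skewN_linear.
HB.instance Definition _ :=
  GRing.isLinear.Build R 'rV[R]_3 'M[R]_4 *:%R (@skewRT R) skewRT_linear.

Lemma vpol_lincomb n m s N (a : 'I_N -> R) (p : 'I_N -> 'rV[R]_n -> 'rV[R]_m) :
  (forall i, vpol s (p i)) -> vpol s (fun y => \sum_i a i *: p i y).
Proof.
move=> pp j; apply: pol_ext (pol_sum (index_enum _) (fun i => polZ (a i) (pp i j))) _.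
by move=> y; rewrite summxE; apply: eq_bigr => i _; rewrite mxE.
Qed.

(** The Nedelec condition enters only through the degree of p.y, which is one
    lower than the degree of p alone would give. *)
Definition ned k (p : 'rV[R]_3 -> 'rV[R]_3) : Prop :=
  vpol k.+1 p /\ pol k.+1 (fun y => dot (p y) y).

Definition rt k (w : 'rV[R]_3 -> 'rV[R]_3) : Prop :=
  exists v h, [/\ vpol k v, pol k h & forall y, w y = v y + h y *: y].

Lemma ned_lincomb k N (a : 'I_N -> R) (p : 'I_N -> 'rV[R]_3 -> 'rV[R]_3) :
  (forall i, ned k (p i)) -> ned k (fun y => \sum_i a i *: p i y).
Proof.
move=> np; split; first by apply: vpol_lincomb => i; exact: (np i).1.
apply: pol_ext (pol_sum (index_enum _) (fun i => polZ (a i) (np i).2)) _ => y.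
by rewrite dot_suml; apply: eq_bigr => i _; rewrite dotZl.
Qed.

Lemma rt_lincomb k N (a : 'I_N -> R) (w : 'I_N -> 'rV[R]_3 -> 'rV[R]_3) :
  (forall i, rt k (w i)) -> rt k (fun y => \sum_i a i *: w i y).
Proof.
move=> /choice[v /choice[h vh]].
exists (fun y => \sum_i a i *: v i y), (fun y => \sum_i a i * h i y); split.
- by apply: vpol_lincomb => i; have [] := vh i.
- by apply: pol_sum => i; apply: polZ; have [] := vh i.
- move=> y; rewrite scaler_suml -big_split; apply: eq_bigr => i _ /=.
  by have [_ _ ->] := vh i; rewrite scalerDr scalerA.
Qed.

Lemma nedelec_ned k p : nedelec k p -> @ned k p.
Proof.
move=> [p1 [p2 [pp1 hp2 p2y pE]]].
have v1 : vpol k p1 by move=> i; apply: (polyfun_pol (pp1 i)); lia.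
have v2 : vpol k.+1 p2 by move=> i; apply: homog_pol (hp2 i).
split=> [i|].
  apply: pol_ext (polD (pol_le (v1 i) _) (v2 i)) _ => // y.
  by rewrite pE mxE.
apply: pol_ext (pol_le (@pol_dot _ _ _ _ 2 _ id v1 _) _) _.
- by move=> i; exact: pol_coord.
- by rewrite addnS addn1.
- by move=> y; rewrite pE dotDl p2y addr0.
Qed.

Lemma raviart_thomas_rt k w : (1 <= k)%N -> raviart_thomas k w -> @rt k w.
Proof.
move=> k1 [w1 [h [pw1 hh wE]]]; exists w1, h; split=> //.
  by move=> i; apply: (polyfun_pol (pw1 i)); lia.
by apply: pol_le (homog_pol hh) _; rewrite prednK.
Qed.

(** Division by x_4^2 - 1; the remainder is determined by the values at the
    two bases. *)
Lemma poly_split_endpoints k (p : {poly R}) : (size p <= k.+1)%N ->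
  exists a b (q : 'I_k.-1 -> R), forall t,
    p.[t] = a + t * b + (1 - t ^+ 2) * \sum_(j < k.-1) t ^+ j * q j.
Proof.
move=> pk; pose d : {poly R} := 'X^2 - 1%:P.
have sd : size d = 3%N by rewrite size_XnsubC.
have d0 : d != 0 by rewrite -size_poly_eq0 sd.
exists (p %% d)`_0, (p %% d)`_1, (fun j => - (p %/ d)`_j) => t.
rewrite {1}(divp_eq p d) !hornerE.
have sm : (size (p %% d)%R <= 2)%N by rewrite -ltnS -sd ltn_modp.
have sq : (size (p %/ d)%R <= k.-1)%N
  by rewrite size_divp// sd leq_subLR (leq_trans pk)//; case: (k).
rewrite (horner_coef_wide t sm) (horner_coef_wide t sq) !big_ord_recr big_ord0 /=.
under [X in _ = _ + _ * X]eq_bigr do rewrite mulrN mulrC.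
rewrite sumrN; ring.
Qed.

Lemma V2_decomp k (F : 'rV[R]_4 -> 'M[R]_4) : (1 <= k)%N -> V2 k F ->
  exists (P : 'I_k -> 'rV[R]_3 -> 'rV[R]_3) (A B : 'rV[R]_3 -> 'rV[R]_3)
    (W : 'I_k.-1 -> 'rV[R]_3 -> 'rV[R]_3),
  [/\ forall j, ned k (P j), rt k A, rt k B, forall j, rt k (W j)
    & forall x, F x = skewN (\sum_(j < k) height x ^+ j *: P j (xyz x))
      + skewRT (A (xyz x) + height x *: B (xyz x)
          + (1 - height x ^+ 2) *: \sum_(j < k.-1) height x ^+ j *: W j (xyz x))].
Proof.
move=> k1 [F1 [F2 [[n [a [b [aP bP F1E]]]] [n' [a' [b' [a'P b'P F2E]]]] FE]]].
have /choice[p pP] : forall i, exists p, nedelec k p /\ (fun y => skewN (p y)) = b i.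
  by move=> i; have [p np pE] := bP i; exists p.
have /choice[w wP] : forall i, exists w,
    raviart_thomas k w /\ (fun y => skewRT (w y)) = b' i.
  by move=> i; have [w nw wE] := b'P i; exists w.
have /choice[al alP] : forall i, exists al : 'I_k -> R,
    forall t, a i t = \sum_(j < k) t ^+ j * al j.
  move=> i; have [q qk aE] := aP i; exists (fun j => q`_j) => t.
  rewrite aE (@horner_coef_wide _ k); last by lia.
  by apply: eq_bigr => j _; rewrite mulrC.
have /choice[be beP] : forall i, exists be : R * R * ('I_k.-1 -> R), forall t,
    a' i t = be.1.1 + t * be.1.2 + (1 - t ^+ 2) * \sum_(j < k.-1) t ^+ j * be.2 j.
  move=> i; have [q qk aE] := a'P i.
  have [|be1 [be2 [be3 beE]]] := @poly_split_endpoints k q; first by lia.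
  by exists (be1, be2, be3) => t; rewrite aE beE.
exists (fun j y => \sum_i al i j *: p i y), (fun y => \sum_i (be i).1.1 *: w i y),
  (fun y => \sum_i (be i).1.2 *: w i y), (fun j y => \sum_i (be i).2 j *: w i y).
split.
- by move=> j; apply: ned_lincomb => i; exact: nedelec_ned (pP i).1.
- by apply: rt_lincomb => i; exact: raviart_thomas_rt (wP i).1.
- by apply: rt_lincomb => i; exact: raviart_thomas_rt (wP i).1.
- by move=> j; apply: rt_lincomb => i; exact: raviart_thomas_rt (wP i).1.
move=> x; rewrite FE F1E F2E; congr (_ + _).
  transitivity (skewN (\sum_i a i (height x) *: p i (xyz x))).
    by rewrite linear_sum; apply: eq_bigr => i _; rewrite -(pP i).2 linearZ.
  congr skewN; under eq_bigr do rewrite alP scaler_suml.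
  rewrite exchange_big; apply: eq_bigr => j _ /=.
  by rewrite scaler_sumr; apply: eq_bigr => i _; rewrite scalerA.
transitivity (skewRT (\sum_i a' i (height x) *: w i (xyz x))).
  by rewrite linear_sum; apply: eq_bigr => i _; rewrite -(wP i).2 linearZ.
congr skewRT; under eq_bigr do rewrite beP !scalerDl -!scalerA.
rewrite !big_split /= -!scaler_sumr; congr (_ + _ + _ *: _).
under [LHS]eq_bigr do rewrite scaler_suml.
rewrite exchange_big; apply: eq_bigr => j _ /=.
by rewrite scaler_sumr; apply: eq_bigr => i _; rewrite scalerA.
Qed.

Definition ispol n (f : 'rV[R]_n -> R) : Prop := exists s, pol s f.

(** The elements of the product spaces of test functions, expanded in the
    powers of x_4. *)
Definition ypow N (Q : 'I_N -> 'rV[R]_3 -> R) (x : 'rV[R]_4) : R :=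
  \sum_(j < N) height x ^+ j * Q j (xyz x).

(** The case s = 0 covers a polynomial degree below -1, where only the empty
    sum is available. *)
Lemma prodpoly_ypow (a b : int) N s (Q : 'I_N -> 'rV[R]_3 -> R) :
  N%:Z <= a + 1 -> (s = 0%N \/ s%:Z <= b + 1) ->
  (forall j, pol s (Q j)) -> prodpoly a b (ypow Q).
Proof.
move=> Na sb pQ.
case: sb => [s0|sb].
  exists 0%N, (fun _ _ => 0), (fun _ _ => 0); split=> [[]//|[]//|x].
  rewrite big_ord0 /ypow big1// => j _.
  by rewrite s0 in pQ; rewrite (pol_size0 (pQ j)) mulr0.
exists N, (fun j t => t ^+ j), Q; split=> //.
  move=> j; exists 'X^j => [|t]; last by rewrite hornerXn.
  by rewrite size_polyXn; have := ltn_ord j; lia.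
by move=> j; exact: pol_polyfun (pQ j) sb.
Qed.

Lemma ispol_ext n (f g : 'rV[R]_n -> R) : ispol f -> f =1 g -> ispol g.
Proof. by move=> pf /funext <-. Qed.

Lemma ispolD n (f g : 'rV[R]_n -> R) :
  ispol f -> ispol g -> ispol (fun y => f y + g y).
Proof.
move=> [s pf] [s' pg]; exists (maxn s s').
by apply: polD; [apply: pol_le pf _|apply: pol_le pg _]; rewrite ?leq_maxl ?leq_maxr.
Qed.

Lemma ispolM n (f g : 'rV[R]_n -> R) :
  ispol f -> ispol g -> ispol (fun y => f y * g y).
Proof. by move=> [s pf] [s' pg]; eexists; exact: polM pf pg. Qed.

Lemma ispolC n (a : R) : ispol (fun _ : 'rV[R]_n => a).
Proof. by exists 1%N; exact: polC. Qed.

Lemma ispolB n (f g : 'rV[R]_n -> R) :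
  ispol f -> ispol g -> ispol (fun y => f y - g y).
Proof.
move=> pf pg; apply: ispol_ext (ispolD pf (ispolM (ispolC _ (-1)) pg)) _ => y.
by rewrite mulN1r.
Qed.

Lemma ispolX n (f : 'rV[R]_n -> R) j : ispol f -> ispol (fun y => f y ^+ j).
Proof.
move=> pf; elim: j => [|j ih]; first exact: ispolC.
by apply: ispol_ext (ispolM pf ih) _ => y; rewrite exprS.
Qed.

Lemma ispol_sum n N (f : 'I_N -> 'rV[R]_n -> R) :
  (forall i, ispol (f i)) -> ispol (fun y => \sum_i f i y).
Proof.
move=> pf; elim: (index_enum _) => [|i r ih].
  by apply: ispol_ext (ispolC _ 0) _ => y; rewrite big_nil.
by apply: ispol_ext (ispolD (pf i) ih) _ => y; rewrite big_cons.
Qed.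

Lemma ispol_comp n m (f : 'rV[R]_n -> R) (E : 'rV[R]_m -> 'rV[R]_n) :
  ispol f -> vpol 2 E -> ispol (fun z => f (E z)).
Proof. by move=> [s pf] pE; exists s; exact: pol_comp. Qed.

Lemma vpol_xyz : vpol 2 (@xyz R).
Proof. by move=> i; apply: pol_ext (pol_coord R (lshift 1 i)) _ => x; rewrite mxE. Qed.

Lemma pol_height : pol 2 (@height R).
Proof. exact: pol_coord. Qed.

Lemma ispol_ypow N (Q : 'I_N -> 'rV[R]_3 -> R) :
  (forall j, ispol (Q j)) -> ispol (ypow Q).
Proof.
move=> pQ; apply: ispol_sum => j; apply: ispolM.
  by apply: ispolX; exists 2%N; exact: pol_height.
by apply: ispol_comp (pQ j) vpol_xyz.
Qed.

Lemma ypow_pt N (Q : 'I_N -> 'rV[R]_3 -> R) y t :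
  ypow Q (pt y t) = \sum_(j < N) t ^+ j * Q j y.
Proof. by rewrite /ypow xyz_pt height_pt. Qed.

Lemma ypow_eq0 N (Q : 'I_N -> 'rV[R]_3 -> R) y :
  (forall t, 0 < t < 1 -> ypow Q (pt y t) = 0) -> forall j, Q j y = 0.
Proof. by move=> Q0; apply: poly_coef_vanish => t t01; rewrite -ypow_pt Q0. Qed.

Lemma ispol_xyz (f : 'rV[R]_3 -> R) : ispol f -> ispol (fun x => f (xyz x)).
Proof. by move=> pf; exact: ispol_comp pf vpol_xyz. Qed.

Lemma pol_xyz s (f : 'rV[R]_3 -> R) : pol s f -> pol s (fun x => f (xyz x)).
Proof. by move=> pf; exact: pol_comp pf vpol_xyz. Qed.

Lemma sum_ypow_dot N (a : 'rV[R]_3) (V : 'I_N -> 'rV[R]_3 -> 'rV[R]_3) x :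
  dot a (\sum_(j < N) height x ^+ j *: V j (xyz x)) = ypow (fun j y => dot a (V j y)) x.
Proof. by rewrite dot_sumr; apply: eq_bigr => j _; rewrite dotZr. Qed.

Lemma ispol_dot_sum N (V : 'I_N -> 'rV[R]_3 -> 'rV[R]_3) :
  (forall j, exists s, vpol s (V j)) ->
  ispol (fun x => dot (\sum_(j < N) height x ^+ j *: V j (xyz x))
                      (\sum_(j < N) height x ^+ j *: V j (xyz x))).
Proof.
move=> pV.
have pS i : ispol (fun x : 'rV[R]_4 => (\sum_(j < N) height x ^+ j *: V j (xyz x)) 0 i).
  have : ispol (ypow (fun j y => V j y 0 i)).
    by apply: ispol_ypow => j; have [s vs] := pV j; exists s; exact: vs.
  move/ispol_ext; apply => x; rewrite summxE; apply: eq_bigr => j _.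
  by rewrite mxE.
by apply: ispol_sum => i; apply: ispolM.
Qed.

End Decomposition.

(** * Integrals over faces, facets and the prism *)

Section FaceIntegrals.
Variable R : realType.
Local Notation vtx := (vert R).
Local Notation grad := (grad_lam R).

Lemma gramE n m p (A : 'M[R]_(n, p)) (B : 'M[R]_(m, p)) i j :
  (A *m B^T) i j = dot (row i A) (row j B).
Proof. by rewrite mxE; apply: eq_bigr => l _; rewrite !mxE. Qed.

(** The vertical direction is a unit vector orthogonal to the horizontal ones,
    so it does not change the area factor. *)
Lemma gram_col_e4 n (A : 'M[R]_(n, 4)) : (forall i, height (row i A) = 0) ->
  \det (col_mx A (e4 R) *m (col_mx A (e4 R))^T) = \det (A *m A^T).
Proof.
move=> A4.
have e4A i : dot (e4 R) (row i A) = 0.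
  by rewrite dot4E xyz_pt height_pt A4 dotC dot0r mulr0 addr0.
rewrite tr_col_mx mul_col_row.
have -> : e4 R *m A^T = 0.
  apply/matrixP => i j; rewrite gramE mxE -[RHS](e4A j).
  by congr dot; apply/rowP => l; rewrite mxE ord1.
rewrite det_ublock [X in _ * X]det_mx11 gramE.
rewrite (_ : row 0 (e4 R) = e4 R); last first.
  by apply/rowP => l; rewrite mxE.
by rewrite dot_pt dot0r add0r !mulr1.
Qed.

Lemma det_mx22 (A : 'M[R]_2) : \det A = A 0 0 * A 1 1 - A 0 1 * A 1 0.
Proof.
rewrite (expand_det_row _ ord0) !big_ord_recl big_ord0 /cofactor !det_mx11 !mxE.
rewrite /= expr0 expr1 mul1r mulN1r addr0 mulrN.
by congr (A _ _ * A _ _ - A _ _ * A _ _); exact: val_inj.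
Qed.

Lemma gram_triangle m : 0 < \det (triangle_frame R m *m (triangle_frame R m)^T).
Proof.
rewrite det_mx22 !gramE !rowK !dot_pt !mulr0 !addr0 !dot3E !mxE.
by elim/ord4_ind: m => /=; lra.
Qed.

(** The area factor must be positive, since a zero factor would leave the
    degrees of freedom on the face without content. *)
Lemma gram_face f : 0 < \det (face_frame R f *m (face_frame R f)^T).
Proof.
case: f => [m b|i j ij]; first exact: gram_triangle.
rewrite [X in 0 < X](@gram_col_e4 1); last first.
  move=> l; rewrite (_ : row l _ = pt (vtx j - vtx i) 0) ?height_pt//.
  by apply/rowP => l'; rewrite mxE ord1.
rewrite det_mx11 gramE (_ : row 0 _ = pt (vtx j - vtx i) 0); last first.
  by apply/rowP => l'; rewrite mxE.
rewrite dot_pt mulr0 addr0 lt_neqAle dot_ge0 andbT eq_sym.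
apply/eqP => /dot_eq0 t0; have := grad_vert R j j i; rewrite t0 dot0r eqxx.
have ji : (j == i) = false by rewrite eq_sym -val_eqE ltn_eqF.
by rewrite ji subr0 => /esym/eqP; rewrite oner_eq0.
Qed.

Lemma facet_frame_Tet b (y : 'rV[R]_3) t :
  pt 0 t + y *m facet_frame R (Tet b) = pt y t.
Proof.
rewrite mulmx_sum_row.
under eq_bigr do rewrite rowK ptZ mulr0.
rewrite sum3E !ptD !addr0; congr pt.
by apply: row3P; rewrite !mxE /=; ring.
Qed.

Lemma gram_facet G : 0 < \det (facet_frame R G *m (facet_frame R G)^T).
Proof.
case: G => [b|m].
  rewrite (_ : _ *m _ = 1%:M) ?det1//; apply/matrixP => i j.
  rewrite gramE !rowK dot_pt mulr0 addr0 /dot (bigD1 i)//= big1 => [|l li].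
    by rewrite !mxE !eqxx mul1r addr0 eq_sym.
  by rewrite !mxE (negPf li) mul0r.
rewrite [X in 0 < X](@gram_col_e4 2); first exact: gram_triangle.
by move=> i; rewrite rowK height_pt.
Qed.

Section Parametric.
Local Notation leb := (@lebesgue_measure R).

(** The integrand G of a degree of freedom agrees with a polynomial g only on
    the face, whereas g vanishes on its whole affine hull. *)
Lemma int2_eq0 (o : 'rV[R]_4) (J : 'M[R]_(2, 4)) (S : set 'rV[R]_4)
    (G g : 'rV[R]_4 -> R) (I : finType) (l : I -> 'rV[R]_2 -> R) s M y :
  0 < \det (J *m J^T) ->
  (forall i, pol s (l i)) ->
  (forall z, S (o + z *m J) <-> forall i, 0 <= l i z) ->
  (forall z, S (o + z *m J) -> in_box M z) ->
  (forall i, 0 < l i y) ->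
  ispol g -> (forall x, S x -> G x = g x /\ 0 <= g x) ->
  int2 o J S G = 0 -> forall z, g (o + z *m J) = 0.
Proof.
move=> J0 pl SE SM ly pg Gg /eqP.
rewrite /int2 mulf_eq0 gt_eqF ?sqrtr_gt0//= => /eqP int0.
have [s' pf] : ispol (fun z => g (o + z *m J)).
  by apply: (ispol_comp pg); exact: vpol_affine.
suff: forall z, (fun z => g (o + z *m J)) z = 0 by [].
have int_eq0 D := @integral_pol_eq0 _ _ _ _ _ _ _ _ _ _ _ D M y
  (coordinate_measure_row2 R) pl pf.
apply: (int_eq0 [set u | S (o + row2 u *m J)]) => //.
- by move=> u; exact: SE.
- by move=> u; exact: SM.
- by move=> u /= /Gg[].
- rewrite -[RHS]int0; apply: eq_Rintegral => u; rewrite inE /=.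
  by move=> /Gg[].
Qed.

Lemma int3_eq0 (o : 'rV[R]_4) (J : 'M[R]_(3, 4)) (S : set 'rV[R]_4)
    (G g : 'rV[R]_4 -> R) (I : finType) (l : I -> 'rV[R]_3 -> R) s M y :
  0 < \det (J *m J^T) ->
  (forall i, pol s (l i)) ->
  (forall z, S (o + z *m J) <-> forall i, 0 <= l i z) ->
  (forall z, S (o + z *m J) -> in_box M z) ->
  (forall i, 0 < l i y) ->
  ispol g -> (forall x, S x -> G x = g x /\ 0 <= g x) ->
  int3 o J S G = 0 -> forall z, g (o + z *m J) = 0.
Proof.
move=> J0 pl SE SM ly pg Gg /eqP.
rewrite /int3 mulf_eq0 gt_eqF ?sqrtr_gt0//= => /eqP int0.
have [s' pf] : ispol (fun z => g (o + z *m J)).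
  by apply: (ispol_comp pg); exact: vpol_affine.
suff: forall z, (fun z => g (o + z *m J)) z = 0 by [].
have int_eq0 D := @integral_pol_eq0 _ _ _ _ _ _ _ _ _ _ _ D M y
  (coordinate_measure_row3 R) pl pf.
apply: (int_eq0 [set u | S (o + row3 u *m J)]) => //.
- by move=> u; exact: SE.
- by move=> u; exact: SM.
- by move=> u /= /Gg[].
- rewrite -[RHS]int0; apply: eq_Rintegral => u; rewrite inE /=.
  by move=> /Gg[].
Qed.

End Parametric.

Lemma ord4_lift_ind (m : 'I_4) (P : 'I_4 -> Prop) :
  P m -> (forall i : 'I_3, P (lift m i)) -> forall n, P n.
Proof. by move=> Pm Pl n; case: (unliftP m n) => [i ->|->]. Qed.

Lemma lam_inj (y z : 'rV[R]_3) : (forall m, lam m y = lam m z) -> y = z.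
Proof.
move=> yz; have [y0 y1 y2 _] := lamE y; have [z0 z1 z2 _] := lamE z.
move: (yz 0) (yz 1) (yz 2); rewrite y0 y1 y2 z0 z1 z2 => ? ? ?.
by apply: row3P; lra.
Qed.

(** The parametrization of the plane of the triangle opposite m by its second
    and third barycentric coordinates. *)
Definition tri_point (m : 'I_4) (a b : R) : 'rV[R]_3 :=
  vtx (lift m ord0) + a *: (vtx (lift m 1) - vtx (lift m ord0))
    + b *: (vtx (lift m 2) - vtx (lift m ord0)).

Lemma lam_tri_point m a b :
  [/\ lam m (tri_point m a b) = 0,
    lam (lift m 0) (tri_point m a b) = 1 - a - b,
    lam (lift m 1) (tri_point m a b) = a
  & lam (lift m 2) (tri_point m a b) = b].
Proof.
have E i j : (lift m i == lift m j) = (i == j) by rewrite (inj_eq lift_inj).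
have F i : (m == lift m i) = false by rewrite (negPf (neq_lift _ _)).
by split; rewrite /tri_point !lam_line lam_vert ?E ?F /=; lra.
Qed.

Lemma lam_tri_centroid (m : 'I_4) (i : 'I_3) :
  0 < lam (lift m i) (tri_point m 3^-1 3^-1).
Proof.
have [_ l0 l1 l2] := lam_tri_point m 3^-1 3^-1.
by elim/ord3_ind: i; rewrite ?l0 ?l1 ?l2; lra.
Qed.

Lemma tri_point_surj m (y : 'rV[R]_3) :
  lam m y = 0 -> y = tri_point m (lam (lift m 1) y) (lam (lift m 2) y).
Proof.
move=> ly; have [l0 l1 l2 l3] := lam_tri_point m (lam (lift m 1) y) (lam (lift m 2) y).
apply: lam_inj; apply: (ord4_lift_ind (m := m)); first by rewrite l0.
elim/ord3_ind => //; rewrite l1.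
have := sum_lam y; rewrite (bigD1_ord m)//= ly sum3E; lra.
Qed.

Lemma triangle_frameE (m : 'I_4) (z : 'rV[R]_2) (t : R) :
  pt (vtx (lift m ord0)) t + z *m triangle_frame R m =
  pt (tri_point m (z 0 0) (z 0 1)) t.
Proof.
rewrite mulmx_sum_row !big_ord_recl big_ord0 addr0 !rowK !ptZ !ptD !mulr0 !addr0.
rewrite addrA; congr (pt (_ + _ *: (vert R (lift m _) - _) + z 0 _ *: (vert R (lift m _) - _)) _);
  exact: val_inj.
Qed.

Lemma triangle_tri_point m a b :
  triangle m (tri_point m a b) <-> forall i : 'I_3, 0 <= lam (lift m i) (tri_point m a b).
Proof.
have [l0 _ _ _] := lam_tri_point m a b; split=> [[/T3P h _] i|h]; first exact: h.
split=> //; apply/T3P; apply: (ord4_lift_ind (m := m)); first by rewrite l0.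
exact: h.
Qed.

Lemma vpol_tri_point n m (a b : 'rV[R]_n -> R) : pol 2 a -> pol 2 b ->
  vpol 2 (fun z => tri_point m (a z) (b z)).
Proof.
move=> pa pb i; set v0 := vtx (lift m ord0).
set d1 := vtx (lift m 1) - v0; set d2 := vtx (lift m 2) - v0.
apply: pol_ext (polD (polD (polC _ 1 (v0 0 i)) (polZ (d1 0 i) pa)) (polZ (d2 0 i) pb)) _.
have rowE (u v w : 'rV[R]_3) x y :
  (u + x *: v + y *: w) 0 i = u 0 i + v 0 i * x + w 0 i * y by rewrite !mxE; ring.
by move=> z; rewrite rowE.
Qed.

Lemma face_int_Tri_eq0 m b (G g : 'rV[R]_4 -> R) :
  ispol g -> (forall x, face_set (Tri m b) x -> G x = g x /\ 0 <= g x) ->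
  face_int (Tri m b) G = 0 ->
  forall y, lam m y = 0 -> g (pt y (endpoint R b)) = 0.
Proof.
move=> pg Gg int0 y ly.
(* The inequality for lam m is left out: lam m vanishes on the whole plane, and
   the remaining ones must hold strictly somewhere. *)
pose l (i : 'I_3) (z : 'rV[R]_2) := lam (lift m i) (tri_point m (z 0 0) (z 0 1)).
have SE (z : 'rV[R]_2) : face_set (Tri m b) (face_origin R (Tri m b) + z *m face_frame R (Tri m b))
    <-> forall i, 0 <= l i z.
  rewrite /= triangle_frameE /= xyz_pt height_pt -triangle_tri_point.
  by split=> [[]|].
rewrite (tri_point_surj ly).
pose z : 'rV[R]_2 := \row_i (if i == 0 then lam (lift m 1) y else lam (lift m 2) y).
have := @int2_eq0 _ _ _ _ g _ l 2 1 (const_mx (3^-1)) (gram_face (Tri m b))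
  _ SE _ _ pg Gg int0 z.
rewrite /= triangle_frameE !mxE /=; apply.
- by move=> i; apply: pol_comp (pol_lam R _) _; apply: vpol_tri_point; exact: pol_coord.
- move=> z' /SE zl; have [_ l0 l1 l2] := lam_tri_point m (z' 0 0) (z' 0 1).
  move: (zl 0) (zl 1) (zl 2); rewrite /l l0 l1 l2 => h0 h1 h2 i.
  by case: i => [[|[|//]] lt_i]; [rewrite (_ : Ordinal _ = 0)|rewrite (_ : Ordinal _ = 1)];
    try exact: val_inj; rewrite ler_norml; lra.
- by move=> i; rewrite /l !mxE; exact: lam_tri_centroid.
Qed.

Lemma facet_int_Tet_eq0 b (G g : 'rV[R]_4 -> R) :
  ispol g -> (forall x, facet_set (Tet b) x -> G x = g x /\ 0 <= g x) ->
  facet_int (Tet b) G = 0 -> forall y, g (pt y (endpoint R b)) = 0.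
Proof.
move=> pg Gg int0 y.
have SE (z : 'rV[R]_3) :
    facet_set (Tet b) (facet_origin R (Tet b) + z *m facet_frame R (Tet b))
    <-> forall i, 0 <= lam i z.
  by rewrite facet_frame_Tet /= xyz_pt height_pt -T3P; split=> [[]|].
have := @int3_eq0 _ _ _ _ g _ (@lam R) 2 1 (const_mx (- 2^-1)) (gram_facet (Tet b))
  _ SE _ _ pg Gg int0 y.
rewrite facet_frame_Tet; apply.
- exact: pol_lam.
- by move=> z /SE/T3P[zi _] i; rewrite ler_norml.
- exact: lam_centroid.
Qed.

Lemma facet_frame_Prism m (z : 'rV[R]_3) :
  facet_origin R (Prism m) + z *m facet_frame R (Prism m) =
  pt (tri_point m (z 0 0) (z 0 1)) (z 0 2).
Proof.
rewrite /= -[z in LHS](@hsubmxK _ 1 2 1) (@mul_row_col _ 1 2 1) addrA triangle_frameE.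
have -> : rsubmx (z : 'rV_(2 + 1)) *m e4 R = z 0 2 *: e4 R.
  rewrite [rsubmx _]mx11_scalar mul_scalar_mx mxE; congr (z 0 _ *: _).
  exact: val_inj.
rewrite ptZ ptD scaler0 addr0 mulr1 add0r !mxE.
by congr (pt (tri_point m (z 0 _) (z 0 _)) _); exact: val_inj.
Qed.

Lemma facet_int_Prism_eq0 m (G g : 'rV[R]_4 -> R) :
  ispol g -> (forall x, facet_set (Prism m) x -> G x = g x /\ 0 <= g x) ->
  facet_int (Prism m) G = 0 -> forall y t, lam m y = 0 -> g (pt y t) = 0.
Proof.
move=> pg Gg int0 y t ly.
pose l (i : 'I_3 + bool) (z : 'rV[R]_3) := match i with
  | inl i => lam (lift m i) (tri_point m (z 0 0) (z 0 1))
  | inr b => 1 + (if b then 1 else -1) * z 0 2 end.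
have SE (z : 'rV[R]_3) :
    facet_set (Prism m) (facet_origin R (Prism m) + z *m facet_frame R (Prism m))
    <-> forall i, 0 <= l i z.
  rewrite facet_frame_Prism /= xyz_pt height_pt triangle_tri_point /T1 /=.
  split=> [[hl ht] [i|[]]|hl]; rewrite /= ?mul1r; [exact: hl|lra|lra|].
  split=> [i|]; first exact: (hl (inl i)).
  by move: (hl (inr true)) (hl (inr false)) => /=; lra.
rewrite (tri_point_surj ly).
pose z : 'rV[R]_3 := \row_i nth 0 [:: lam (lift m 1) y; lam (lift m 2) y; t] i.
have := @int3_eq0 _ _ _ _ g _ l 2 1 (\row_i nth 0 [:: 3^-1; 3^-1; 0] i)
  (gram_facet (Prism m)) _ SE _ _ pg Gg int0 z.
rewrite facet_frame_Prism !mxE /=; apply.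
- case=> [i|b] /=.
    by apply: pol_comp (pol_lam R _) _; apply: vpol_tri_point; exact: pol_coord.
  by apply: polD; [exact: polC|apply: polZ; exact: pol_coord].
- move=> z' /SE zl; have [_ l0 l1 l2] := lam_tri_point m (z' 0 0) (z' 0 1).
  move: (zl (inl 0)) (zl (inl 1)) (zl (inl 2)) (zl (inr true)) (zl (inr false)).
  rewrite /l l0 l1 l2 => h0 h1 h2 h3 h4.
  by elim/ord3_ind; rewrite ler_norml; lra.
- by case=> [i|[]] /=; rewrite !mxE /= ?lam_tri_centroid//; lra.
Qed.

Lemma face_int_Quad_eq0 (i j : 'I_4) (ij : (i < j)%N) (G g : 'rV[R]_4 -> R) :
  ispol g -> (forall x, face_set (Quad ij) x -> G x = g x /\ 0 <= g x) ->
  face_int (Quad ij) G = 0 ->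
  forall s t, g (pt (vtx i + s *: (vtx j - vtx i)) t) = 0.
Proof.
move=> pg Gg int0 s t.
have ji : (j == i) = false by rewrite eq_sym -val_eqE ltn_eqF.
have zE (z : 'rV[R]_2) : face_origin R (Quad ij) + z *m face_frame R (Quad ij) =
    pt (vtx i + z 0 0 *: (vtx j - vtx i)) (z 0 1).
  rewrite /= -[z in LHS](@hsubmxK _ 1 1 1) (@mul_row_col _ 1 1 1).
  rewrite [lsubmx _]mx11_scalar [rsubmx _]mx11_scalar !mul_scalar_mx !ptZ !ptD.
  rewrite scaler0 addr0 mulr0 !add0r mulr1 !mxE.
  by congr (pt (_ + z 0 _ *: _) (z 0 _)); exact: val_inj.
pose l (i : bool * bool) (z : 'rV[R]_2) :=
  if i.1 then (if i.2 then z 0 0 else 1 - z 0 0)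
  else (if i.2 then 1 + z 0 1 else 1 - z 0 1).
have SE (z : 'rV[R]_2) :
    face_set (Quad ij) (face_origin R (Quad ij) + z *m face_frame R (Quad ij))
    <-> forall i, 0 <= l i z.
  rewrite zE /= xyz_pt height_pt /T1 /edge /= T3P.
  split=> [[[hl _] ht] [[] []]|hl] /=; rewrite /l /=; try lra.
  - by have := hl j; rewrite lam_line lam_vert eqxx ji /=; lra.
  - by have := hl i; rewrite lam_line lam_vert eqxx [i == j]eq_sym ji /=; lra.
  move: (hl (true, true)) (hl (true, false)) (hl (false, true)) (hl (false, false)).
  rewrite /l /= => h1 h2 h3 h4; split; last lra.
  split=> m; last by move=> mi mj; rewrite lam_line lam_vert (negPf mi) (negPf mj) /=; lra.
  rewrite lam_line lam_vert; have [->|mi] := eqVneq m i.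
    by rewrite [i == j]eq_sym ji /=; lra.
  by case: eqP => /=; lra.
have := @int2_eq0 _ _ _ _ g _ l 2 1 (\row_i nth 0 [:: 2^-1; 0] i)
  (gram_face (Quad ij)) _ SE _ _ pg Gg int0 (\row_i nth 0 [:: s; t] i).
rewrite zE !mxE /=; apply.
- by case=> [[] []]; rewrite /l /=; try exact: pol_coord;
    [apply: polB|apply: polD|apply: polB]; try exact: pol_coord; exact: polC.
- move=> z /SE hl.
  move: (hl (true, true)) (hl (true, false)) (hl (false, true)) (hl (false, false)).
  rewrite /l /= => h1 h2 h3 h4 i'.
  by case: i' => [[|[|//]] lt_i]; [rewrite (_ : Ordinal _ = 0)|rewrite (_ : Ordinal _ = 1)];
    try exact: val_inj; rewrite ler_norml; lra.
- by case=> [[] []]; rewrite /l /= !mxE /=; lra.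
Qed.

Lemma intN4_eq0 (G g : 'rV[R]_4 -> R) :
  ispol g -> (forall x, N4 x -> G x = g x /\ 0 <= g x) ->
  intN4 G = 0 -> forall x, g x = 0.
Proof.
move=> [s' pg] Gg int0.
pose l (i : 'I_4 + bool) (x : 'rV[R]_4) := match i with
  | inl i => lam i (xyz x)
  | inr b => 1 + (if b then 1 else -1) * height x end.
have SE x : N4 x <-> forall i, 0 <= l i x.
  rewrite /N4 /= T3P /T1 /=.
  split=> [[hl ht] [i|[]]|hl]; rewrite /= ?mul1r; [exact: hl|lra|lra|].
  split=> [i|]; first exact: (hl (inl i)).
  by move: (hl (inr true)) (hl (inr false)) => /=; lra.
have pl i : pol 2 (l i).
  case: i => [i|b] /=; first by apply: pol_comp (pol_lam R _) _; exact: vpol_xyz.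
  by apply: polD; [exact: polC|apply: polZ; exact: pol_height].
have int_eq0 D := @integral_pol_eq0 _ _ _ _ _ _ _ _ _ _ _ D 1
  (pt (const_mx (- 2^-1)) 0) (coordinate_measure_row4 R) pl pg.
apply: (int_eq0 [set u | N4 (row4 u)]) => //.
- by move=> u; exact: SE.
- move=> u [[hT _] hh] i; rewrite ler_norml.
  case: (@split_ordP 3 1 i) => j ->; first by have := hT j; rewrite mxE.
  by rewrite ord1 -heightE.
- by case=> [i|[]] /=; rewrite ?xyz_pt ?height_pt ?lam_centroid//; lra.
- by move=> u /= /Gg[].
- rewrite -[RHS]int0; apply: eq_Rintegral => u; rewrite inE /=.
  by move=> /Gg[].
Qed.

End FaceIntegrals.

(** * The reference spaces on the tetrahedron *)

Section ReferenceSpaces.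
Variable R : realType.
Local Notation vtx := (vert R).
Local Notation grad := (grad_lam R).

Lemma grad_span (v : 'rV[R]_3) : (forall m, dot (grad m) v = 0) -> v = 0.
Proof.
by move=> v0; apply: lam_inj => m; rewrite -[v]add0r lamD v0 addr0.
Qed.

Lemma rt_vpol k w : rt k w -> vpol k.+1 (w : 'rV[R]_3 -> 'rV[R]_3).
Proof.
move=> [v [h [pv ph wE]]] i.
apply: pol_ext (polD (pol_le (pv i) _) (polX i ph)) _ => // y.
by rewrite wE !mxE [h y * _]mulrC.
Qed.

(** The part h y of w has g_m.(h y) = (lam_m - lam_m 0) h, so on the plane
    lam_m = 0 the flux has the degree of h. *)
Lemma rt_flux k w : @rt R k w -> exists2 h, pol k h & forall m,
  exists2 u, pol k u & forall y, dot (grad m) (w y) = lam m y * h y + u y.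
Proof.
move=> [v [h [pv ph wE]]]; exists h => // m.
exists (fun y => dot (v y) (grad m) - lam m 0 * h y) => [|y].
  by apply: polB; [exact: pol_dotC|exact: polZ].
by have := lamD m 0 y; rewrite add0r => ->; rewrite wE dotDr dotZr dotC; ring.
Qed.

(** The function h is the same for the four coordinates; the corrections e m
    have one degree less. *)
Lemma rt_factor k w : @rt R k w ->
  (forall m y, lam m y = 0 -> dot (grad m) (w y) = 0) ->
  exists h (e : 'I_4 -> 'rV[R]_3 -> R), [/\ pol k h, forall m, pol k.-1 (e m)
    & forall m y, dot (grad m) (w y) = lam m y * (h y + e m y)].
Proof.
move=> /rt_flux[h ph fl] w0; exists h.
have /choice[e eP] : forall m, exists e, pol k.-1 e /\
    forall y, dot (grad m) (w y) = lam m y * (h y + e y).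
  move=> m; have [u pu uE] := fl m.
  have [|e pe eE] := lam_div (m := m) pu.
    by move=> y ly; have := uE y; rewrite w0// ly mul0r add0r.
  by exists e; split=> // y; rewrite uE eE mulrDr.
by exists e; split=> // m; have [] := eP m.
Qed.

Lemma sum_grad_dot (v : 'rV[R]_3) : \sum_m dot (grad m) v = 0.
Proof. by rewrite -dot_suml sum_grad dotC dot0r. Qed.

(** Both sides have the same components along the g_m, as sum_m g_m = 0 gives
    h + sum_d e_d lam_d = 0.  The index 2 is the one vertex d for which y - v_d
    is missing from the interior test fields. *)
Lemma rt_bubble k w : @rt R k w ->
  (forall m y, lam m y = 0 -> dot (grad m) (w y) = 0) ->
  exists2 q : 'I_4 -> 'rV[R]_3 -> R, (forall d, pol k.-1 (q d)) &
    forall y, q 2 y = 0 /\ w y = \sum_d (q d y * lam d y) *: (y - vtx d).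
Proof.
move=> rw w0; have [h [e [ph pe eE]]] := rt_factor rw w0.
exists (fun d y => e 2 y - e d y) => [d|y]; first exact: polB.
split; first by rewrite subrr.
apply/eqP; rewrite -subr_eq0; apply/eqP; apply: grad_span => m.
have s0 : \sum_m (lam m y * h y + lam m y * e m y) = 0.
  rewrite -[RHS](sum_grad_dot (w y)); apply: eq_bigr => m' _.
  by rewrite eE mulrDr.
rewrite big_split /= -mulr_suml sum_lam mul1r in s0.
rewrite dotBr dot_sumr eE.
have -> : \sum_d dot (grad m) (((e 2 y - e d y) * lam d y) *: (y - vtx d)) =
    lam m y * (\sum_d (e 2 y - e d y) * lam d y) - (e 2 y - e m y) * lam m y.
  rewrite mulr_sumr (bigD1 m)//= [in RHS](bigD1 m)//= dotZr grad_dot_vert eqxx mulr1n.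
  rewrite [X in _ + X = _](eq_bigr (fun d => lam m y * ((e 2 y - e d y) * lam d y))); first by ring.
  by move=> d dm; rewrite dotZr grad_dot_vert eq_sym (negPf dm) subr0 mulrC.
have -> : \sum_d (e 2 y - e d y) * lam d y = e 2 y + h y.
  under eq_bigr do rewrite mulrBl [e _ y * _]mulrC [e _ y * lam _ _]mulrC.
  rewrite sumrB -mulr_suml sum_lam mul1r.
  by move/eqP: s0; rewrite addr_eq0 => /eqP ->; rewrite addrC.
ring.
Qed.

Definition edge_null (p : 'rV[R]_3 -> 'rV[R]_3) : Prop := forall (i j : 'I_4) y,
  (forall m, m != i -> m != j -> lam m y = 0) -> dot (p y) (vtx j - vtx i) = 0.

(** The vectors y - v_m, m <> M, span the plane of face M at almost all of its
    points: this is the vanishing of the tangential trace. *)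
Definition face_null (p : 'rV[R]_3 -> 'rV[R]_3) : Prop := forall (M m : 'I_4) y,
  m != M -> lam M y = 0 -> dot (p y) (y - vtx m) = 0.

Lemma ned_dot_vert k p a : @ned R k p -> pol k.+1 (fun y => dot (p y) (y - a)).
Proof.
move=> [vp np]; apply: pol_ext (polB np (pol_dotC a vp)) _ => y.
by rewrite dotBr.
Qed.

Lemma edge_pointE (i j : 'I_4) (y : 'rV[R]_3) : i != j ->
  (forall m, m != i -> m != j -> lam m y = 0) ->
  y = vtx i + lam j y *: (vtx j - vtx i).
Proof.
move=> ij y0; have s1 := sum_lam y.
rewrite (bigD1 i)//= (bigD1 j) 1?eq_sym//= big1 ?addr0 in s1; last first.
  by move=> m /andP[mi mj]; exact: y0.
apply: lam_inj => m; rewrite lam_line lam_vert.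
have [->|mi] := eqVneq m i; first by rewrite (negPf ij) /=; lra.
have [->|mj] := eqVneq m j; first by rewrite /=; lra.
by rewrite y0//=; lra.
Qed.

(** The projection onto an edge line that keeps lam_j. *)
Definition edge_point (i j : 'I_4) (y : 'rV[R]_3) : 'rV[R]_3 :=
  vtx i + lam j y *: (vtx j - vtx i).

(** Along the edge, p.(y - v_i) is lam_j times the tangential component and has
    degree at most k, so the component has degree at most k - 1. *)
Lemma ned_edge k p i j : i != j -> @ned R k p ->
  pol k (fun y => dot (p (edge_point i j y)) (vtx j - vtx i)).
Proof.
move=> ij np; have [vp _] := np.
have vE : vpol 2 (edge_point i j).
  move=> l; apply: pol_ext (polD (polC _ 1 (vtx i 0 l))
    (polZ ((vtx j - vtx i) 0 l) (pol_lam R j))) _ => y.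
  by rewrite [in RHS]mxE; congr (_ + _); rewrite [in RHS]mxE mulrC.
have sE y : dot (p (edge_point i j y)) (edge_point i j y - vtx i)
    = lam j y * dot (p (edge_point i j y)) (vtx j - vtx i).
  by rewrite {2}/edge_point addrAC subrr add0r dotZr.
have [|h ph hE] := lam_div (m := j) (pol_comp (ned_dot_vert (vtx i) np) vE).
  by move=> y ly; rewrite sE ly mul0r.
apply: (pol_ext ph) => y; apply/eqP; rewrite -subr_eq0; apply/eqP.
have pD : pol k.+1 (fun y => h y - dot (p (edge_point i j y)) (vtx j - vtx i)).
  apply: polB; first exact: pol_le ph _.
  apply: (pol_comp (f := fun y => dot (p y) (vtx j - vtx i))) vE.
  exact: pol_dotC.
apply: (lam_cancel (f := fun y => _ - _) ij pD) => t /=.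
by rewrite mulrBr -hE sE subrr.
Qed.

Lemma edge_nullP p :
  (forall (i j : 'I_4) s, (i < j)%N ->
    dot (p (vtx i + s *: (vtx j - vtx i))) (vtx j - vtx i) = 0) ->
  edge_null p.
Proof.
move=> h i j y y0; have [ij|ji|/val_inj ij] := ltngtP i j.
- by rewrite (edge_pointE _ y0) ?h// -val_eqE ltn_eqF.
- rewrite -opprB -scaleN1r dotZr (@edge_pointE j i y) ?h ?mulr0//.
    by rewrite -val_eqE ltn_eqF.
  by move=> m mj mi; exact: y0.
- by rewrite ij subrr dot0r.
Qed.

(** Composing with the projection onto the face along the edge from a to M
    makes p.(y - v_a) a polynomial on the whole space; it vanishes where lam_b
    or lam_c does, because that is an edge through v_a. *)
Lemma ned_face_factor k p (M a b c : 'I_4) : uniq [:: M; a; b; c] ->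
  ned k p -> edge_null p ->
  exists2 q, pol k.-1 q & forall y, lam M y = 0 ->
    dot (p y) (y - vtx a) = lam b y * lam c y * q y.
Proof.
rewrite /= !inE !negb_or => /and4P[/and3P[Ma Mb Mc] /andP[ab ac] bc _] np ep.
pose E y := y - lam M y *: (vtx M - vtx a).
have lE m y : lam m (E y) = lam m y - lam M y * ((m == M)%:R - (m == a)%:R).
  by rewrite /E -scaleNr lam_line mulNr.
have [|||q pq qE] := @lam_divs _ [:: b; c] k.+1 (fun y => dot (p (E y)) (E y - vtx a)).
- by rewrite /= inE bc.
- exact: (@pol_proj _ _ (fun y => dot (p y) (y - vtx a)) M (vtx M - vtx a)
    (ned_dot_vert _ np)).
- move=> m y; rewrite !inE => mbc lm.
  (* The other end of the edge cut out on face M by lam m = 0. *)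
  pose n := if m == b then c else b.
  have only l : l != a -> l != n -> lam l (E y) = 0.
    move=> la ln; rewrite lE; have [->|lM] := eqVneq l M.
      by rewrite (negPf Ma) /=; lra.
    rewrite (negPf la) subrr mulr0 subr0; suff -> : l = m by [].
    apply/eqP; apply: contraT => nlm.
    (* Otherwise M, a, b, c and l would be five indices. *)
    have := max_card (mem [:: M; a; b; c; l]).
    rewrite (card_uniqP _) ?card_ord//= !inE !negb_or Ma Mb Mc ab ac bc.
    rewrite ![_ == l]eq_sym lM la.
    move: mbc nlm ln; rewrite /n; case: (eqVneq m b) => [-> _ -> -> //|_ /=].
    by move/eqP => -> -> ->.
  have an : a != n by rewrite /n; case: ifP.
  by rewrite {2}(edge_pointE an only) addrAC subrr add0r dotZr ep// mulr0.
exists q => [|y ly]; first by rewrite /= subSS subn1 in pq.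
have -> : y = E y by rewrite /E ly scale0r subr0.
by rewrite qE !big_cons big_nil mulr1 /E ly scale0r subr0.
Qed.

(** With s_m = p.(y - v_m) = q_m prod_(j <> m) lam_j, numbering from 0, the
    coefficients are q_0, q_0 + q_1 and - q_3 times the products PhiN; they
    come from (lam_a g_b - lam_b g_a).(y - v_m) = [m = a] lam_b - [m = b] lam_a.
    The difference of the two sides is then orthogonal to y - v_m for m = 0, 1
    and 3, and these vectors span where lam 2 is not 0. *)
Lemma ned_bubble k p : ned k p -> face_null p ->
  exists2 Q : 'I_3 -> 'rV[R]_3 -> R, (forall r, pol (k - 2) (Q r)) &
    forall y, p y = \sum_(r < 3) (Q r y * PhiN r y) *: vecN r y.
Proof.
move=> np fp.
have div (m : 'I_4) ms : uniq ms -> m \notin ms -> exists2 q, pol (k.+1 - size ms) q &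
    forall y, dot (p y) (y - vtx m) = (\prod_(j <- ms) lam j y) * q y.
  move=> ums mms; apply: lam_divs => //; first exact: ned_dot_vert np.
  move=> j y jms ly; apply: (fp j) => //.
  by apply: contraNneq mms => ->.
have [||q0 pq0 q0E] := div 0 [:: 1; 2; 3] => //.
have [||q1 pq1 q1E] := div 1 [:: 0; 2; 3] => //.
have [||q3 pq3 q3E] := div 3 [:: 0; 1; 2] => //.
rewrite /= subSS in pq0 pq1 pq3.
pose Q (r : 'I_3) (y : 'rV[R]_3) :=
  nth 0 [:: q0 y; q0 y + q1 y; -1 * q3 y] r.
have pQ r : pol (k - 2) (Q r).
  by elim/ord3_ind: r => //=; [exact: polD|exact: polZ].
exists Q => // y.
pose D (y : 'rV[R]_3) := p y - \sum_(r < 3) (Q r y * PhiN r y) *: vecN r y.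
suff D0 z : D z = 0 by apply/eqP; rewrite -subr_eq0; apply/eqP/D0.
have idx0 : [/\ idx 0 0 = 0, idx 0 1 = 1, idx 0 2 = 2 & idx 0 3 = 3].
  by split; exact: val_inj.
have idx1 : [/\ idx 1 0 = 1, idx 1 1 = 2, idx 1 2 = 3 & idx 1 3 = 0].
  by split; exact: val_inj.
have idx2 : [/\ idx 2 0 = 2, idx 2 1 = 3, idx 2 2 = 0 & idx 2 3 = 1].
  by split; exact: val_inj.
have [[a0 b0 c0 d0] [a1 b1 c1 d1] [a2 b2 c2 d2]] := And3 idx0 idx1 idx2.
have Dv z' : [/\ dot (D z') (z' - vtx 0) = 0, dot (D z') (z' - vtx 1) = 0
    & dot (D z') (z' - vtx 3) = 0].
  rewrite /D sum3E /vecN /PhiN a0 b0 c0 d0 a1 b1 c1 d1 a2 b2 c2 d2 /Q /=.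
  rewrite !dotBl !dotDl !dotZl !dotBl !dotZl !grad_dot_vert q0E q1E q3E.
  rewrite !big_cons !big_nil -!val_eqE /=.
  by split; ring.
have Dz z' : D z' 0 0 = 0 /\ D z' 0 1 = 0 /\ lam 2 z' * D z' 0 2 = 0.
  have [h0 h1 h3] := Dv z'; have [e0 e1 _] := vert_sub3 (D z').
  have z0 : D z' 0 0 = 0.
    have : dot (D z') (vtx 0 - vtx 3) = dot (D z') (z' - vtx 3) - dot (D z') (z' - vtx 0).
      by rewrite -dotBr; congr dot; rewrite opprB [RHS]addrC -addrA addKr.
    by rewrite e0 h0 h3; lra.
  have z1 : D z' 0 1 = 0.
    have : dot (D z') (vtx 1 - vtx 3) = dot (D z') (z' - vtx 3) - dot (D z') (z' - vtx 1).
      by rewrite -dotBr; congr dot; rewrite opprB [RHS]addrC -addrA addKr.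
    by rewrite e1 h1 h3; lra.
  split=> //; split=> //; have [_ _ -> _] := lamE z'.
  by move: h3; rewrite dot3E z0 z1 !mxE /=; lra.
have [s pD] : ispol (fun z => D z 0 2).
  have plam m : ispol (@lam R m) by exists 2%N; exact: pol_lam.
  have : ispol (fun z => p z 0 2 - \sum_(r < 3) Q r z * PhiN r z *
      (lam (idx r 0) z * grad (idx r 1) 0 2 - lam (idx r 1) z * grad (idx r 0) 0 2)).
    apply: ispolB; first by exists k.+1; exact: np.1.
    apply: ispol_sum => r; apply: ispolM.
      by apply: ispolM; [exists (k - 2)%N|apply: ispolM].
    by apply: ispolB; apply: ispolM => //; exact: ispolC.
  move/ispol_ext; apply => z'; rewrite mxE; congr (_ + _).
  by rewrite mxE summxE; congr (- _); apply: eq_bigr => r _; rewrite !mxE.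
have [z0 [z1 _]] := Dz z.
apply: row3P; rewrite [RHS]mxE //.
apply: (lam_cancel (f := fun z => D z 0 2) (m := 2) (l := 0) _ pD) => // t /=.
by have [_ [_ ->]] := Dz (z + t *: (vtx 2 - vtx 0)).
Qed.

Lemma sum_idx3 (f : 'I_4 -> 'rV[R]_3) :
  f 2 = 0 -> \sum_d f d = \sum_(r < 3) f (idx r 3).
Proof.
move=> f2; rewrite sum4E sum3E f2 addr0 addrC addrA.
by congr (f _ + f _ + f _); exact: val_inj.
Qed.

(** The lowest-order face field a, b, c is det (g_a, g_b, g_c) times y - v_d; the
    determinants are +-1/8. *)
Lemma vecRTE (r : 'I_3) : exists a : R, a != 0 /\
  forall y, vecRT r y = a *: (y - vtx (idx r 3)).
Proof.
exists (if r == 1 then - 8^-1 else 8^-1); split.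
  by case: ifP => _; rewrite ?oppr_eq0 invr_eq0 pnatr_eq0.
move=> y; have [l0 l1 l2 l3] := lamE y.
have i0 : [/\ idx 0 0 = 0, idx 0 1 = 1 & idx 0 2 = 2].
  by split; exact: val_inj.
have i1 : [/\ idx 1 0 = 1, idx 1 1 = 2 & idx 1 2 = 3].
  by split; exact: val_inj.
have i2 : [/\ idx 2 0 = 2, idx 2 1 = 3 & idx 2 2 = 0].
  by split; exact: val_inj.
have [[a0 b0 c0] [a1 b1 c1] [a2 b2 c2]] := And3 i0 i1 i2.
have cE (u v : 'rV[R]_3) : cross u v = \row_(i < 3) nth 0
    [:: u 0 1 * v 0 2 - u 0 2 * v 0 1; u 0 2 * v 0 0 - u 0 0 * v 0 2;
        u 0 0 * v 0 1 - u 0 1 * v 0 0] i.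
  by have [h0 h1 h2] := crossE u v; apply: row3P; rewrite [RHS]mxE ?h0 ?h1 ?h2.
rewrite /vecRT !cE; elim/ord3_ind: r;
  rewrite ?a0 ?b0 ?c0 ?a1 ?b1 ?c1 ?a2 ?b2 ?c2 ?l0 ?l1 ?l2 ?l3.
all: by apply: row3P; rewrite !mxE /=; lra.
Qed.

Lemma ddot_skewN (p w s : 'rV[R]_3) :
  ddot (skewN p + skewRT w) (skewN s) = 2 * dot p s.
Proof.
rewrite /ddot sum4E !sum4E !mxE /= dot3E; ring.
Qed.

Lemma ddot_skewRT (p w s : 'rV[R]_3) :
  ddot (skewN p + skewRT w) (skewRT s) = 2 * dot w s.
Proof.
rewrite /ddot sum4E !sum4E !mxE /= dot3E; ring.
Qed.

End ReferenceSpaces.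

(** * Unisolvence *)

Section Unisolvence.
Variables (R : realType) (k : nat) (k_gt0 : (1 <= k)%N) (c : face_choice R).
Variables (F : 'rV[R]_4 -> 'M[R]_4) (hdof : dofs_vanish k c F).
Variables (P : 'I_k -> 'rV[R]_3 -> 'rV[R]_3) (A B : 'rV[R]_3 -> 'rV[R]_3).
Variable W : 'I_k.-1 -> 'rV[R]_3 -> 'rV[R]_3.
Local Notation vtx := (vert R).
Local Notation grad := (grad_lam R).

Let p (x : 'rV[R]_4) : 'rV[R]_3 := \sum_(j < k) height x ^+ j *: P j (xyz x).
Let w (x : 'rV[R]_4) : 'rV[R]_3 := A (xyz x) + height x *: B (xyz x)
  + (1 - height x ^+ 2) *: \sum_(j < k.-1) height x ^+ j *: W j (xyz x).

Hypotheses (nedP : forall j, ned k (P j)) (rtA : rt k A) (rtB : rt k B)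
  (rtW : forall j, rt k (W j))
  (FE : forall x, F x = skewN (p x) + skewRT (w x)).

Section Base.
Variable b : bool.
Let wb (y : 'rV[R]_3) := A y + endpoint R b *: B y.

Let wbE y : w (pt y (endpoint R b)) = wb y.
Proof.
rewrite /w xyz_pt height_pt (_ : endpoint R b ^+ 2 = 1) ?subrr ?scale0r ?addr0//.
by case: b; rewrite /= ?sqrrN expr1n.
Qed.

Let rt_wb : rt k wb.
Proof.
have [vA [hA [pvA phA AE]]] := rtA; have [vB [hB [pvB phB BE]]] := rtB.
exists (fun y => vA y + endpoint R b *: vB y), (fun y => hA y + endpoint R b * hB y).
split=> [i||y].
- apply: pol_ext (polD (pvA i) (polZ (endpoint R b) (pvB i))) _ => y.
  by rewrite !mxE.
- exact: polD (polZ _ _).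
- by rewrite /wb AE BE scalerDr scalerDl scalerA addrACA.
Qed.

(** The trace g_m.w on a triangular face has degree at most k - 1, so it is a
    test function against itself. *)
Lemma base_flux m y : lam m y = 0 -> dot (grad m) (wb y) = 0.
Proof.
have [h ph fl] := rt_flux rt_wb; have [u pu uE] := fl m.
have [C C0 trE] := face_trace_Tri c m b.
(* The factor C of the trace has an unknown sign; putting it into the test
   function turns the integrand into a square. *)
have pq : polyfun (k%:Z - 1) (fun x => C * u (xyz x)).
  by apply: (pol_polyfun (polZ C (pol_xyz pu))); lia.
move=> ly; rewrite uE ly mul0r add0r; apply/eqP.
suff : (C * u y) ^+ 2 == 0 by rewrite sqrf_eq0 mulf_eq0 (negPf C0).
rewrite -[u y](congr1 u (xyz_pt y (endpoint R b))); apply/eqP.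
apply: (face_int_Tri_eq0 (g := fun x => (C * u (xyz x)) ^+ 2) _ _
  (dof_tri hdof m b pq) ly).
- by apply: ispolX; apply: ispolM; [exact: ispolC|apply: ispol_xyz; exists k].
- move=> x [[_ lx] hx]; split; last exact: sqr_ge0.
  rewrite (trE _ _ _ _ (FE x)) -[x in w x]pt_xyz hx wbE uE lx mul0r add0r.
  ring.
Qed.

(** The test field sum_m e_m g_m pairs with w to
    sum_m e_m lam_m (h + e_m) = sum_m lam_m (h + e_m)^2, where the two differ by
    h sum_m g_m.w = 0. *)
Lemma base_zero y : wb y = 0.
Proof.
have [h [e [ph pe eE]]] := rt_factor rt_wb base_flux.
have [C C0 trE] := facet_trace_Tet c b.
pose q (x : 'rV[R]_4) := pt (C *: \sum_m e m (xyz x) *: grad m) 0.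
pose g (x : 'rV[R]_4) := C ^+ 2 * \sum_m lam m (xyz x) * (h (xyz x) + e m (xyz x)) ^+ 2.
have qE y' : dot (wb y') (\sum_m e m y' *: grad m) =
    \sum_m lam m y' * (h y' + e m y') ^+ 2.
  have s0 : h y' * \sum_m dot (grad m) (wb y') = 0 by rewrite sum_grad_dot mulr0.
  rewrite dot_sumr -[LHS]add0r -[X in X + _]s0 mulr_sumr -big_split /=.
  by apply: eq_bigr => m _; rewrite dotZr [dot (wb _) _]dotC eE; ring.
have g0 : forall y', g (pt y' (endpoint R b)) = 0.
  apply: (facet_int_Tet_eq0 (G := fun x => dot (facet_trace c (Tet b) F x) (q x))).
  - apply: ispolM; first exact: ispolC.
    apply: ispol_sum => m; apply: ispolM.
      by apply: ispol_xyz; exists 2%N; exact: pol_lam.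
    by apply: ispolX; apply: ispolD; apply: ispol_xyz; [exists k|exists k.-1].
  - move=> x [Tx hx]; split.
      rewrite (trE _ _ _ _ (FE x)) -{1}[x]pt_xyz hx wbE /q ptZ dot_pt mulr0 addr0.
      by rewrite dotZl dotZr qE mulrA -expr2.
    rewrite mulr_ge0 ?sqr_ge0// sumr_ge0// => m _.
    by rewrite mulr_ge0 ?sqr_ge0//; exact: (T3P _).1.
  - apply: (dof_tet hdof) => [x _ u /normal_TetP[a ->]|i].
      by rewrite dot_pt dotC dot0r mulr0 addr0.
    case: (@split_ordP 3 1 i) => j ->.
      have : pol k.-1 (fun x : 'rV[R]_4 => C * \sum_m grad m 0 j * e m (xyz x)).
        by apply: polZ; apply: pol_sum => m; apply: polZ; exact: pol_xyz.
      move=> pq; apply: (pol_polyfun (pol_ext pq _)); last by lia.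
      move=> x; rewrite ptEl mxE summxE; congr (_ * _); apply: eq_bigr => m _.
      by rewrite [RHS]mxE mulrC.
    apply: (@pol_polyfun _ _ _ k.-1); last by lia.
    have p0 : pol k.-1 (fun _ : 'rV[R]_4 => 0) by exact: pol0.
    apply: (pol_ext p0) => x.
    by rewrite ord1 -heightE height_pt.
have he m y' : h y' + e m y' = 0.
  have phe : pol k (fun y' => h y' + e m y').
    by apply: polD => //; apply: pol_le (pe m) _; rewrite leq_pred.
  apply: (pol_identity (l := @lam R) (y := const_mx (- 2^-1)) _ _ phe).
  - exact: pol_lam.
  - exact: lam_centroid.
  - move=> z lz; have := g0 z; rewrite /g xyz_pt => /eqP.
    rewrite mulf_eq0 sqrf_eq0 (negPf C0)/= psumr_eq0 => [/allP/(_ m)|i _].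
      rewrite mem_index_enum => /(_ isT).
      by rewrite mulf_eq0 sqrf_eq0 gt_eqF// => /eqP.
    by rewrite mulr_ge0 ?sqr_ge0// ltW.
by apply: grad_span => m; rewrite eE he mulr0.
Qed.

End Base.

Lemma AB0 y : A y = 0 /\ B y = 0.
Proof.
have h1 := base_zero true y; have h2 := base_zero false y.
move: h1 h2; rewrite /= scale1r scaleN1r => h1 h2.
have A0 : A y = 0.
  apply/rowP => i; move/rowP/(_ i): h1; move/rowP/(_ i): h2.
  by rewrite !mxE; lra.
by split=> //; rewrite -h1 A0 add0r.
Qed.

Let wE x : w x = (1 - height x ^+ 2) *: \sum_(j < k.-1) height x ^+ j *: W j (xyz x).
Proof. by rewrite /w (AB0 _).1 (AB0 _).2 scaler0 !add0r. Qed.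

(** On a lateral facet the flux of w carries the factor 1 - x_4^2, which is
    nonnegative there and lowers the degree in x_4 to that of the test space. *)
Lemma W_flux j m y : lam m y = 0 -> dot (grad m) (W j y) = 0.
Proof.
have /choice[u uP] : forall j, exists u, pol k u /\
    forall y, lam m y = 0 -> dot (grad m) (W j y) = u y.
  move=> j'; have [h ph fl] := rt_flux (rtW j'); have [u pu uE] := fl m.
  by exists u; split=> // y' ly; rewrite uE ly mul0r add0r.
have pu j' : pol k (u j') by have [] := uP j'.
have uE j' y' : lam m y' = 0 -> dot (grad m) (W j' y') = u j' y'.
  by have [_] := uP j'; apply.
have [C C0 trE] := facet_trace_Prism c m.
have pq : prodpoly (k%:Z - 2) (k%:Z - 1) (ypow (fun j y => - C * u j y)).
  apply: (@prodpoly_ypow _ _ _ _ k); [lia|right; lia|].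
  by move=> j'; exact: polZ.
have ypowZ x : ypow (fun j y => - C * u j y) x = - C * ypow u x.
  by rewrite /ypow mulr_sumr; apply: eq_bigr => j' _; rewrite mulrCA.
move=> ly; rewrite uE//; move: j; apply: ypow_eq0 => t /andP[t0 t1].
suff /eqP : (1 - t ^+ 2) * (C * ypow u (pt y t)) ^+ 2 = 0.
  rewrite mulf_eq0 sqrf_eq0 mulf_eq0 (negPf C0)/= => /orP[|/eqP//].
  by rewrite gt_eqF//; nra.
rewrite -{1}[t](height_pt y).
apply: (facet_int_Prism_eq0 (g := fun x => (1 - height x ^+ 2) * (C * ypow u x) ^+ 2)
  _ _ (dof_prism_e4 hdof m pq) t ly).
- apply: ispolM; last first.
    apply: ispolX; apply: ispolM; first exact: ispolC.
    by apply: ispol_ypow => j'; exists k.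
  apply: ispolB; first exact: ispolC.
  by apply: ispolX; exists 2%N; exact: pol_height.
- move=> x [[_ lx] hx]; split.
    rewrite (trE _ _ _ _ (FE x)) dotZl /e4 dot_pt dot0r add0r mulr1 wE dotZr.
    rewrite sum_ypow_dot ypowZ (_ : ypow _ x = ypow u x); first by ring.
    by apply: eq_bigr => j' _; rewrite uE.
  by rewrite mulr_ge0 ?sqr_ge0//; move: hx; rewrite /T1/=; nra.
Qed.

(** By rt_bubble, the sum of the x_4^j W_j, times the bubble of x_4, is one of
    the interior test fields. *)
Lemma W_zero j y : W j y = 0.
Proof.
have /choice[q qP] : forall j, exists q : 'I_4 -> 'rV[R]_3 -> R,
    (forall d, pol k.-1 (q d)) /\ forall y, q 2 y = 0 /\
      W j y = \sum_d (q d y * lam d y) *: (y - vtx d).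
  by move=> j'; have [q pq qE] := rt_bubble (rtW j') (W_flux j'); exists q.
have /choice[a aP] := @vecRTE R.
pose S (x : 'rV[R]_4) := \sum_(j < k.-1) height x ^+ j *: W j (xyz x).
pose Q r := ypow (fun j y => (a r)^-1 * q j (idx r 3) y).
have pQ r : prodpoly (k%:Z - 2) (k%:Z - 2) (Q r).
  apply: (@prodpoly_ypow _ _ _ _ k.-1); [lia|right; lia|].
  by move=> j'; apply: polZ; exact: (qP j').1.
(* The three interior fields are attached to the vertices idx r 3, that is all
   but the third one. *)
have SE x : S x = \sum_(r < 3) (ypow (fun j y => q j (idx r 3) y) x
    * lam (idx r 3) (xyz x)) *: (xyz x - vtx (idx r 3)).
  transitivity (\sum_(j < k.-1) \sum_(r < 3) (height x ^+ j *
      q j (idx r 3) (xyz x) * lam (idx r 3) (xyz x)) *: (xyz x - vtx (idx r 3))).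
    apply: eq_bigr => j' _; have [q2 ->] := (qP j').2 (xyz x).
    rewrite sum_idx3; last by rewrite q2 mul0r scale0r.
    by rewrite scaler_sumr; apply: eq_bigr => r _; rewrite scalerA mulrA.
  rewrite exchange_big; apply: eq_bigr => r _ /=; rewrite -scaler_suml.
  by rewrite /ypow mulr_suml.
have QE x : \sum_(r < 3) (Q r x * PsiRT r (xyz x) * bubble1 (height x))
    *: vecRT r (xyz x) = bubble1 (height x) *: S x.
  rewrite SE scaler_sumr; apply: eq_bigr => r _.
  have [a0 ->] := aP r; rewrite !scalerA; congr (_ *: _).
  have -> : Q r x = (a r)^-1 * ypow (fun j y => q j (idx r 3) y) x.
    by rewrite /Q /ypow mulr_sumr; apply: eq_bigr => j' _; rewrite mulrCA.
  by rewrite /PsiRT; field.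
have g0 : forall x, (1 - height x ^+ 2) ^+ 2 / 2 * dot (S x) (S x) = 0.
  apply: (intN4_eq0 _ _ (dof_inner_RT hdof pQ)).
    apply: ispolM.
      apply: ispolM; last exact: ispolC.
      apply: ispolX; apply: ispolB; first exact: ispolC.
      by apply: ispolX; exists 2%N; exact: pol_height.
    by apply: ispol_dot_sum => j'; exists k.+1; exact: rt_vpol.
  move=> x hx; split.
    by rewrite FE ddot_skewRT QE wE dotZl dotZr /bubble1 /nu1 /nu2 -/(S x); field.
  by rewrite mulr_ge0 ?dot_ge0// mulr_ge0 ?sqr_ge0//; lra.
apply/rowP => i; rewrite [RHS]mxE; move: j.
apply: (@ypow_eq0 _ _ (fun j y => W j y 0 i)) => t /andP[t0 t1].
have : S (pt y t) = 0.
  apply: dot_eq0; have /eqP := g0 (pt y t).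
  rewrite height_pt mulf_eq0 (mulf_eq0 (_ ^+ 2)) sqrf_eq0 invr_eq0 pnatr_eq0 orbF => /orP[|/eqP//].
  by rewrite gt_eqF//; nra.
move/rowP/(_ i); rewrite [RHS]mxE => <-.
by rewrite summxE; apply: eq_bigr => j' _; rewrite [RHS]mxE.
Qed.

Lemma w_zero x : w x = 0.
Proof. by rewrite wE big1 ?scaler0// => j _; rewrite W_zero scaler0. Qed.

Lemma P_edge_null l : edge_null (P l).
Proof.
apply: edge_nullP => i j s ij.
have ij' : i != j by rewrite -val_eqE ltn_eqF.
pose D l (y : 'rV[R]_3) := dot (P l (edge_point i j y)) (vtx j - vtx i).
have pD l' : pol k (D l') by exact: ned_edge.
have [C C0 trE] := face_trace_Quad c ij.
have pq : prodpoly (k%:Z - 1) (k%:Z - 1) (ypow (fun l y => C * D l y)).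
  apply: (@prodpoly_ypow _ _ _ _ k); [lia|right; lia|].
  by move=> l'; exact: polZ.
have ypowZ x : ypow (fun l y => C * D l y) x = C * ypow D x.
  by rewrite /ypow mulr_sumr; apply: eq_bigr => l' _; rewrite mulrCA.
set y := vtx i + _.
have yE : edge_point i j y = y.
  congr (_ + _ *: _); rewrite lam_line lam_vert eqxx [j == i]eq_sym (negPf ij') /=.
  by rewrite subr0 add0r mulr1.
suff : D l y = 0 by rewrite /D yE.
move: l; apply: ypow_eq0 => t _.
suff /eqP : (C * ypow D (pt y t)) ^+ 2 = 0.
  by rewrite sqrf_eq0 mulf_eq0 (negPf C0)/= => /eqP.
apply: (face_int_Quad_eq0 (g := fun x => (C * ypow D x) ^+ 2) _ _
  (dof_quad hdof ij pq) s t).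
- apply: ispolX; apply: ispolM; first exact: ispolC.
  by apply: ispol_ypow => l'; exists k.
- move=> x [[Tx ex] hx]; split; last exact: sqr_ge0.
  rewrite (trE _ _ _ _ (FE x)) ypowZ dotC sum_ypow_dot.
  rewrite (_ : ypow _ x = ypow D x); first by ring.
  apply: eq_bigr => l' _; congr (_ * _); rewrite dotC /D /edge_point.
  by rewrite -(edge_pointE ij' ex).
Qed.

(** With tau = q_a (v_a - v_d) + q_b (v_b - v_d), p.tau is minus a sum of squares
    whose weights are positive inside the triangle; q_a and q_b vanish there,
    hence on its plane.  As the trace is g x p, the test field is g x tau. *)
Lemma P_face_null l : face_null (P l).
Proof.
move=> M.
set a := lift M 0; set b := lift M 1; set d := lift M 2.
have E i j : (lift M i == lift M j) = (i == j) by rewrite (inj_eq lift_inj).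
have N i : (M == lift M i) = false by rewrite (negPf (neq_lift _ _)).
have /choice[qa qaP] : forall l, exists q, pol k.-1 q /\ forall y, lam M y = 0 ->
    dot (P l y) (y - vtx a) = lam b y * lam d y * q y.
  move=> l'; have [|q pq qE] := @ned_face_factor _ k (P l') M a b d _ (nedP l') (@P_edge_null l').
    by rewrite /= !inE !E !N.
  by exists q.
have /choice[qb qbP] : forall l, exists q, pol k.-1 q /\ forall y, lam M y = 0 ->
    dot (P l y) (y - vtx b) = lam a y * lam d y * q y.
  move=> l'; have [|q pq qE] := @ned_face_factor _ k (P l') M b a d _ (nedP l') (@P_edge_null l').
    by rewrite /= !inE !E !N.
  by exists q.
have pqa l' : pol k.-1 (qa l') := (qaP l').1.
have pqb l' : pol k.-1 (qb l') := (qbP l').1.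
have sa l' y : lam M y = 0 -> dot (P l' y) (y - vtx a) = lam b y * lam d y * qa l' y.
  exact: (qaP l').2.
have sb l' y : lam M y = 0 -> dot (P l' y) (y - vtx b) = lam a y * lam d y * qb l' y.
  exact: (qbP l').2.
have sd l' y : lam M y = 0 ->
    dot (P l' y) (y - vtx d) = - (lam a y * lam b y * (qa l' y + qb l' y)).
  move=> lM; apply/eqP; rewrite -subr_eq0 opprK; apply/eqP.
  have [s ps] : ispol (fun y => dot (P l' y) (y - vtx d)
      + lam a y * lam b y * (qa l' y + qb l' y)).
    have plam m : ispol (@lam R m) by exists 2%N; exact: pol_lam.
    apply: ispolD; first by exists k.+1; exact: ned_dot_vert.
    by apply: ispolM; [exact: ispolM|apply: ispolD; exists k.-1].
  apply: (lam_cancel (f := fun y => _ + _) (m := d) (l := a) _ ps); first by rewrite E.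
  move=> t; set z := y + _ => /=.
  have zM : lam M z = 0 by rewrite lam_line !N lM subrr mulr0 addr0.
  (* The relation sum_m lam_m s_m = 0, restricted to the face. *)
  have : dot (P l' z) (\sum_m lam m z *: (z - vtx m)) = 0.
    have zE := sum_lam_vert z.
    under eq_bigr do rewrite scalerBr.
    by rewrite sumrB zE -scaler_suml sum_lam scale1r subrr dot0r.
  rewrite dot_sumr (bigD1_ord M)//= zM scale0r dot0r add0r sum3E !dotZr.
  rewrite -/a -/b -/d sa// sb// => h.
  by rewrite mulrDr; rewrite -[RHS]h; ring.
pose tau l (y : 'rV[R]_3) :=
  qa l y *: (vtx a - vtx d) + qb l y *: (vtx b - vtx d).
have tauE l' y : dot (grad M) (tau l' y) = 0.
  by rewrite dotDr !dotZr !grad_vert !N subrr !mulr0 addr0.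
have [C C0 trE] := facet_trace_Prism c M.
pose q (x : 'rV[R]_4) := \sum_(l < k) height x ^+ l *:
  (- C *: cross (grad M) (tau l (xyz x))).
have ptau l' i : pol k.-1 (fun y => tau l' y 0 i).
  apply: (pol_ext (polD (polZ ((vtx a - vtx d) 0 i) (pqa l'))
    (polZ ((vtx b - vtx d) 0 i) (pqb l')))) => y.
  rewrite [RHS]mxE [X in _ = X + _]mxE [X in _ = _ + X]mxE.
  by rewrite [qa _ _ * _]mulrC [qb _ _ * _]mulrC.
have pq i : prodpoly (k%:Z - 1) (k%:Z - 2) (fun x => q x 0 i).
  rewrite (_ : (fun x => q x 0 i) =
    ypow (fun l y => - C * cross (grad M) (tau l y) 0 i)); last first.
    apply/funext => x; rewrite summxE; apply: eq_bigr => l' _.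
    by rewrite [LHS]mxE [X in _ * X = _]mxE.
  apply: (@prodpoly_ypow _ _ _ _ k.-1); [lia|right; lia|].
  move=> l'; apply: polZ.
  apply: (pol_ext (polB (polZ (grad M 0 (i + 1)) (ptau l' (i + 2)))
    (polZ (grad M 0 (i + 2)) (ptau l' (i + 1))))) => y.
  by rewrite [RHS]mxE.
have tq x : facet_set (Prism M) x -> tangent_to (triangle M) (q x).
  move=> _ u /normal_triangleP[al ->]; rewrite dotZl dot_sumr big1 ?mulr0//.
  by move=> l' _; rewrite !dotZr dot_cross_self !mulr0.
pose Qa := ypow qa; pose Qb := ypow qb.
pose g (x : 'rV[R]_4) := C ^+ 2 * dot (grad M) (grad M) *
  (lam a (xyz x) * lam b (xyz x) * (Qa x + Qb x) ^+ 2
   + lam b (xyz x) * lam d (xyz x) * Qa x ^+ 2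
   + lam a (xyz x) * lam d (xyz x) * Qb x ^+ 2).
have g0 : forall y t, lam M y = 0 -> g (pt y t) = 0.
  apply: (facet_int_Prism_eq0 _ _ (dof_prism_tangent hdof tq pq)).
    have pl m : ispol (fun x : 'rV[R]_4 => lam m (xyz x)).
      by apply: ispol_xyz; exists 2%N; exact: pol_lam.
    have pa : ispol Qa by apply: ispol_ypow => l'; exists k.-1.
    have pb : ispol Qb by apply: ispol_ypow => l'; exists k.-1.
    apply: ispolM; first exact: ispolC.
    apply: ispolD; [apply: ispolD|]; (apply: ispolM; [exact: ispolM|apply: ispolX]) => //.
    exact: ispolD.
  move=> x [[/T3P Tx lM] hx]; split; last first.
    apply: mulr_ge0; first by rewrite mulr_ge0 ?sqr_ge0 ?dot_ge0.
    by apply: addr_ge0; [apply: addr_ge0|]; apply: mulr_ge0; rewrite ?sqr_ge0//;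
      exact: mulr_ge0.
  rewrite (trE _ _ _ _ (FE x)) dotZl dot_pt mulr0 addr0 dot_sumr mulr_sumr.
  have sE m (s : 'I_k -> 'rV[R]_3 -> R) :
      (forall l, dot (P l (xyz x)) (xyz x - vtx m) = s l (xyz x)) ->
      dot (p x) (xyz x - vtx m) = ypow s x.
    by move=> h; rewrite dotC sum_ypow_dot; apply: eq_bigr => l' _; rewrite dotC h.
  have vE m : dot (p x) (vtx m - vtx d) =
      dot (p x) (xyz x - vtx d) - dot (p x) (xyz x - vtx m).
    by rewrite -dotBr opprB [in RHS]addrC -addrA addKr.
  have paE : dot (p x) (xyz x - vtx a) = lam b (xyz x) * lam d (xyz x) * Qa x.
    rewrite (sE a (fun l y => lam b y * lam d y * qa l y) (fun l => sa l _ lM)) /Qa /ypow mulr_sumr.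
    by apply: eq_bigr => l' _; rewrite mulrCA.
  have pbE : dot (p x) (xyz x - vtx b) = lam a (xyz x) * lam d (xyz x) * Qb x.
    rewrite (sE b (fun l y => lam a y * lam d y * qb l y) (fun l => sb l _ lM)) /Qb /ypow mulr_sumr.
    by apply: eq_bigr => l' _; rewrite mulrCA.
  have pdE : dot (p x) (xyz x - vtx d) =
      - (lam a (xyz x) * lam b (xyz x) * (Qa x + Qb x)).
    rewrite (sE d (fun l y => - (lam a y * lam b y * (qa l y + qb l y)))
      (fun l => sd l _ lM)) /Qa /Qb /ypow -big_split mulr_sumr -sumrN.
    by apply: eq_bigr => l' _ /=; ring.
  rewrite (eq_bigr (fun l : 'I_k => - (C ^+ 2 * dot (grad M) (grad M)) *
      (height x ^+ l * qa l (xyz x) * dot (p x) (vtx a - vtx d)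
       + height x ^+ l * qb l (xyz x) * dot (p x) (vtx b - vtx d)))); last first.
    move=> l' _; rewrite !dotZr cross_lagrange tauE mulr0 subr0 [dot _ (tau _ _)]dotDr !dotZr.
    ring.
  rewrite -mulr_sumr big_split -!mulr_suml /=.
  rewrite -[\sum_(i < k) height x ^+ i * qa i _]/(Qa x)
    -[\sum_(i < k) height x ^+ i * qb i _]/(Qb x).
  rewrite !vE paE pbE pdE /g.
  ring.
have C2g0 : C ^+ 2 * dot (grad M) (grad M) != 0.
  by rewrite mulf_neq0 ?grad_neq0// sqrf_eq0.
have Qab0 t y : lam M y = 0 -> 0 < lam a y -> 0 < lam b y -> 0 < lam d y ->
    Qa (pt y t) = 0 /\ Qb (pt y t) = 0.
  move=> lM la lb ld; have /eqP := g0 y t lM.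
  rewrite /g xyz_pt mulf_eq0 (negPf C2g0)/= => /eqP h.
  have ha : 0 <= lam a y * lam b y * (Qa (pt y t) + Qb (pt y t)) ^+ 2.
    by rewrite mulr_ge0 ?sqr_ge0// mulr_ge0// ltW.
  have hb : 0 <= lam b y * lam d y * Qa (pt y t) ^+ 2.
    by rewrite mulr_ge0 ?sqr_ge0// mulr_ge0// ltW.
  have hd : 0 <= lam a y * lam d y * Qb (pt y t) ^+ 2.
    by rewrite mulr_ge0 ?sqr_ge0// mulr_ge0// ltW.
  have /eqP : lam b y * lam d y * Qa (pt y t) ^+ 2 = 0 by lra.
  have /eqP : lam a y * lam d y * Qb (pt y t) ^+ 2 = 0 by lra.
  rewrite !(mulf_eq0 (_ * _)) !sqrf_eq0 !mulf_eq0 (gt_eqF la) (gt_eqF lb) (gt_eqF ld).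
  by move=> /eqP -> /eqP ->.
have q0 (f : 'I_k -> 'rV[R]_3 -> R) : (forall l, pol k.-1 (f l)) ->
    (forall y t, lam M y = 0 -> 0 < lam a y -> 0 < lam b y -> 0 < lam d y ->
      ypow f (pt y t) = 0) -> forall l y, lam M y = 0 -> f l y = 0.
  move=> pf f0 l' y lM; rewrite (tri_point_surj lM).
  pose z : 'rV[R]_2 := \row_i (if i == 0 then lam (lift M 1) y else lam (lift M 2) y).
  have pft : pol k.-1 (fun z : 'rV[R]_2 => f l' (tri_point M (z 0 0) (z 0 1))).
    by apply: (pol_comp (pf l')); apply: vpol_tri_point; exact: pol_coord.
  have pll (i : 'I_3) : pol 2 (fun z : 'rV[R]_2 =>
      lam (lift M i) (tri_point M (z 0 0) (z 0 1))).
    by apply: (pol_comp (pol_lam R (lift M i))); apply: vpol_tri_point; exact: pol_coord.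
  have := pol_identity (y := const_mx (3^-1)) pll _ pft _ z.
  rewrite !mxE /=; apply.
    by move=> i; exact: lam_tri_centroid.
  move=> z' lz; have [lM0 _ _ _] := lam_tri_point M (z' 0 0) (z' 0 1).
  clear pft; move: l'; apply: (@ypow_eq0 _ _ f) => t _.
  by apply: f0 => //; [exact: (lz 0)|exact: (lz 1)|exact: (lz 2)].
have qa0 := q0 _ pqa (fun y t lM la lb ld => (Qab0 t y lM la lb ld).1).
have qb0 := q0 _ pqb (fun y t lM la lb ld => (Qab0 t y lM la lb ld).2).
move=> m y mM lM; move: m mM; apply: (ord4_lift_ind (m := M)).
  by rewrite eqxx.
by elim/ord3_ind => _; rewrite ?sa ?sb ?sd// ?qa0 ?qb0//; ring.
Qed.

Lemma p_zero x : p x = 0.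
Proof.
have /choice[Q QP] : forall l, exists Q : 'I_3 -> 'rV[R]_3 -> R,
    (forall r, pol (k - 2) (Q r)) /\
    forall y, P l y = \sum_(r < 3) (Q r y * PhiN r y) *: vecN r y.
  by move=> l; have [Q pQ QE] := ned_bubble (nedP l) (@P_face_null l); exists Q.
pose q r := ypow (fun l => Q l r).
have pq r : prodpoly (k%:Z - 1) (k%:Z - 3) (q r).
  apply: (@prodpoly_ypow _ _ _ _ (k - 2)); [lia| |by move=> l; exact: (QP l).1].
  have [k2|k2] := leqP k 2; [left|right]; lia.
have qE y : \sum_(r < 3) (q r y * PhiN r (xyz y)) *: vecN r (xyz y) = p y.
  rewrite /p; under [RHS]eq_bigr do rewrite (QP _).2 scaler_sumr.
  rewrite exchange_big; apply: eq_bigr => r _ /=.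
  rewrite /q /ypow mulr_suml scaler_suml; apply: eq_bigr => l _.
  by rewrite scalerA mulrA.
suff : 2 * dot (p x) (p x) = 0.
  by move/eqP; rewrite mulf_eq0 pnatr_eq0 => /eqP/dot_eq0.
apply: (intN4_eq0 (g := fun x => 2 * dot (p x) (p x)) _ _ (dof_inner_N hdof pq)).
  apply: ispolM; first exact: ispolC.
  by apply: ispol_dot_sum => l; exists k.+1; exact: (nedP l).1.
move=> y _; split; last by rewrite mulr_ge0 ?dot_ge0.
by rewrite FE ddot_skewN qE.
Qed.

Lemma F_zero x : F x = 0.
Proof. by rewrite FE p_zero w_zero !linear0 addr0. Qed.

End Unisolvence.

Theorem lemma5p3 (R : realType) (k : nat) (hk : (1 <= k)%N) (c : face_choice R)
  (F : 'rV[R]_4 -> 'M[R]_4) (hF : V2 k F) (hdof : dofs_vanish k c F) :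
  forall x : 'rV[R]_4, F x = 0.
Proof.
have [P [A [B [W [nP rA rB rW FE]]]]] := V2_decomp hk hF.
exact: (F_zero hk hdof nP rA rB rW FE).
Qed.
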